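(* Let $K$ be a field and let $H$ be a Hopf algebra over $K$. The following assertions are equivalent: (1) There is an $ad$-coinvariant integral $t\in H$. (2) The forgetful functor ${}_{H}^{C}\mathfrak{M}_{H}^{C}\to{}^{C}\mathfrak{M}^{C}$ is separable for every coalgebra $C$ in ${}_{H}\mathfrak{M}_{H}$. (3) The forgetful functor ${}_{H}^{H}\mathfrak{M}_{H}^{H}\to{}^{H}\mathfrak{M}^{H}$ is separable. (3b) $H$ is separable as an algebra in the monoidal category $({}^{H}\mathfrak{M}^{H},\otimes,K)$. (4) The forgetful functor ${}_{H}^{H}\mathcal{YD}\to{}^{H}\mathfrak{M}$ is separable. (4b) $K$ is $\mathcal{E}_{G}$-projective in ${}_{H}^{H}\mathcal{YD}$, where $G$ is the forgetful functor ${}_{H}^{H}\mathcal{YD}\to{}^{H}\mathfrak{M}$ of (4).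
   Context: Notation: $\Delta(h)=h_1\otimes h_2$ (Sweedler), $\varepsilon$ the counit, $S$ the antipode of $H$; $\otimes=\otimes_K$. $ad$-coinvariant integral: an element $t\in H$ such that (a) $ht=\varepsilon(h)t$ for all $h\in H$; (b) $t_1S(t_3)\otimes t_2=1_H\otimes t$; (c) $\varepsilon(t)=1_K$. Separable functor: a functor $U:\mathfrak{B}\to\mathfrak{A}$ such that the natural transformation $\mathrm{Hom}_{\mathfrak B}(\bullet,\bullet)\to \mathrm{Hom}_{\mathfrak A}(U(\bullet),U(\bullet))$, $f\mapsto U(f)$, of functors $\mathfrak{B}^{op}\times\mathfrak{B}\to\mathfrak{Sets}$ has a left inverse natural transformation. Categories: ${}_H\mathfrak{M}_H$ is the monoidal category of $H$-bimodules with $\otimes_K$ carrying diagonal actions on both sides and unit $K$ (actions via $\varepsilon$). For a coalgebra $C$ in ${}_H\mathfrak{M}_H$, ${}_{H}^{C}\mathfrak{M}_{H}^{C}$ is the category of $C$-bicomodules in ${}_H\mathfrak{M}_H$ ($C$-bicomodules that are $H$-bimodules with $H$-bilinear coactions); ${}^C\mathfrak{M}^C$ is the category of ordinary $C$-bicomodules. $H$ is a coalgebra in ${}_H\mathfrak{M}_H$ via its multiplication. ${}^H\mathfrak{M}^H$ is the monoidal category of $H$-bicomodules with $\otimes_K$ carrying codiagonal coactions on both sides and unit $K$ (trivial coactions via $1_H$); $H$ is an algebra in it via $\Delta$. An algebra $(A,m,u)$ in a monoidal category $\mathcal{M}$ is separable if $m$ has a section $A\to A\otimes A$ in the category ${}_{A}\mathcal{M}_{A}$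 of $A$-bimodules in $\mathcal{M}$. ${}_H^H\mathcal{YD}$ is the category of left-left Yetter-Drinfeld modules: left $H$-modules and left $H$-comodules $V$ with $(h v)_{-1}\otimes (hv)_0=h_1v_{-1}S(h_3)\otimes h_2v_0$. The object $K$ has action via $\varepsilon$ and coaction $k\mapsto 1_H\otimes k$. For a functor $G:\mathfrak{B}\to\mathfrak{A}$, $\mathcal{E}_G$ is the class of morphisms $f$ of $\mathfrak{B}$ such that $G(f)$ has a section (right inverse) in $\mathfrak{A}$. An object $P$ is $\mathcal{E}_G$-projective if for every $f:X\to Y$ in $\mathcal{E}_G$ every morphism $P\to Y$ factors through $f$. *)

(* Defs.v *)
From HB Require Import structures.
From mathcomp Require Import all_boot all_algebra.
From mathcomp Require Import boolp.
From mathcomp Require Import generic_quotient.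

Set Implicit Arguments.
Unset Strict Implicit.
Unset Printing Implicit Defensive.

Import GRing.Theory.
Local Open Scope ring_scope.
Local Open Scope quotient_scope.

Section TensorConstruction.
Variables (K : fieldType) (V W : lmodType K).

Definition bilin (Z : lmodType K) (f : V -> W -> Z) : Prop :=
  (forall w, linear (f ^~ w)) /\ (forall v, linear (f v)).

Definition fsum (Z : lmodType K) (f : V -> W -> Z) (s : seq (V * W)) : Z :=
  \sum_(p <- s) f p.1 p.2.

(* Formal sums of pure tensors are identified when no bilinear map into a
   K-space separates them; the quotient is the tensor product over K. *)
Definition tens_rel : rel (seq (V * W)) := fun s t =>
  `[< forall (Z : lmodType K) (f : V -> W -> Z), bilin f -> fsum f s = fsum f t >].

Lemma tens_rel_refl : reflexive tens_rel.
Proof. by move=> s; apply/asboolP. Qed.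

Lemma tens_rel_sym : symmetric tens_rel.
Proof.
by move=> s t; apply/asboolP/asboolP=> h Z f hf; rewrite h.
Qed.

Lemma tens_rel_trans : transitive tens_rel.
Proof.
move=> s t u /asboolP h1 /asboolP h2; apply/asboolP=> Z f hf.
by rewrite h1 // h2.
Qed.

Canonical tens_equiv := EquivRel tens_rel tens_rel_refl tens_rel_sym tens_rel_trans.

Definition qtensor : Type := {eq_quot tens_equiv}.
HB.instance Definition _ := Choice.on qtensor.

Definition qtcls (s : seq (V * W)) : qtensor := \pi_{eq_quot tens_equiv} s.
Definition qtrepr (x : qtensor) : seq (V * W) := @repr _ {eq_quot tens_equiv} x.

Lemma qtreprK x : qtcls (qtrepr x) = x.
Proof. exact: reprK. Qed.

Lemma qtclsP s t :
  (forall (Z : lmodType K) (f : V -> W -> Z), bilin f -> fsum f s = fsum f t) <->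
  qtcls s = qtcls t.
Proof.
split=> [h|/eqmodP/asboolP//].
by apply/eqmodP/asboolP.
Qed.

Definition qtlift (Z : lmodType K) (f : V -> W -> Z) (x : qtensor) : Z :=
  fsum f (qtrepr x).

Lemma qtlift_cls (Z : lmodType K) (f : V -> W -> Z) s :
  bilin f -> qtlift f (qtcls s) = fsum f s.
Proof. by move=> hf; apply/qtclsP: Z f hf; rewrite qtreprK. Qed.

Lemma qtensP (x y : qtensor) :
  (forall (Z : lmodType K) (f : V -> W -> Z), bilin f -> qtlift f x = qtlift f y) ->
  x = y.
Proof.
by move=> h; rewrite -[x]qtreprK -[y]qtreprK; apply/qtclsP=> Z f hf; apply: h.
Qed.

Definition qtzero : qtensor := qtcls [::].
Definition qtadd (x y : qtensor) : qtensor := qtcls (qtrepr x ++ qtrepr y).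
Definition qtscale (a : K) (x : qtensor) : qtensor :=
  qtcls [seq (a *: p.1, p.2) | p <- qtrepr x].
Definition qtopp (x : qtensor) : qtensor := qtscale (- 1) x.

Lemma qtlift_zero (Z : lmodType K) (f : V -> W -> Z) :
  bilin f -> qtlift f qtzero = 0.
Proof. by move=> hf; rewrite qtlift_cls // /fsum big_nil. Qed.

Lemma qtlift_add (Z : lmodType K) (f : V -> W -> Z) x y :
  bilin f -> qtlift f (qtadd x y) = qtlift f x + qtlift f y.
Proof. by move=> hf; rewrite qtlift_cls // /fsum big_cat. Qed.

Lemma bilinZl (Z : lmodType K) (f : V -> W -> Z) a v w :
  bilin f -> f (a *: v) w = a *: f v w.
Proof.
case=> h _; have h0: f 0 w = 0.
  by have := h w (-1) 0 0; rewrite scaler0 add0r scaleN1r addNr.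
by have := h w a v 0; rewrite addr0 h0 addr0.
Qed.

Lemma qtlift_scale (Z : lmodType K) (f : V -> W -> Z) a x :
  bilin f -> qtlift f (qtscale a x) = a *: qtlift f x.
Proof.
move=> hf; rewrite qtlift_cls // /qtlift /fsum big_map scaler_sumr.
by apply: eq_bigr => p _; rewrite bilinZl.
Qed.

Lemma qtlift_opp (Z : lmodType K) (f : V -> W -> Z) x :
  bilin f -> qtlift f (qtopp x) = - qtlift f x.
Proof. by move=> hf; rewrite qtlift_scale // scaleN1r. Qed.

Let qtliftE := (qtlift_zero, qtlift_add, qtlift_opp, qtlift_scale).

Lemma taddA : associative qtadd.
Proof. by move=> x y z; apply: qtensP => Z f hf; rewrite !qtliftE // addrA. Qed.
Lemma taddC : commutative qtadd.
Proof. by move=> x y; apply: qtensP => Z f hf; rewrite !qtliftE // addrC. Qed.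
Lemma tadd0 : left_id qtzero qtadd.
Proof. by move=> x; apply: qtensP => Z f hf; rewrite !qtliftE // add0r. Qed.
Lemma taddN : left_inverse qtzero qtopp qtadd.
Proof. by move=> x; apply: qtensP => Z f hf; rewrite !qtliftE // addNr. Qed.

HB.instance Definition _ := GRing.isZmodule.Build qtensor taddA taddC tadd0 taddN.

Lemma tscaleA (a b : K) (v : qtensor) : qtscale a (qtscale b v) = qtscale (a * b) v.
Proof. by apply: qtensP => Z f hf; rewrite !qtliftE // scalerA. Qed.
Lemma tscale1 : left_id 1 qtscale.
Proof. by move=> x; apply: qtensP => Z f hf; rewrite !qtliftE // scale1r. Qed.
Lemma tscaleDr : right_distributive qtscale +%R.
Proof. by move=> a x y; apply: qtensP => Z f hf; rewrite !qtliftE // scalerDr. Qed.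
Lemma tscaleDl (v : qtensor) : {morph qtscale^~ v : a b / a + b >-> a + b}.
Proof. by move=> a b; apply: qtensP => Z f hf; rewrite !qtliftE // scalerDl. Qed.

HB.instance Definition _ := GRing.Zmodule_isLmodule.Build K qtensor
  tscaleA tscale1 tscaleDr tscaleDl.

Definition qtmk (v : V) (w : W) : qtensor := qtcls [:: (v, w)].

Lemma qtlift_linear (Z : lmodType K) (f : V -> W -> Z) : bilin f -> linear (qtlift f).
Proof. by move=> hf a x y; rewrite qtlift_add // qtlift_scale. Qed.

Lemma qtlift_tmk (Z : lmodType K) (f : V -> W -> Z) v w :
  bilin f -> qtlift f (qtmk v w) = f v w.
Proof. by move=> hf; rewrite qtlift_cls // /fsum big_seq1. Qed.

Lemma qtmk_bilin : bilin qtmk.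
Proof.
split=> [w a x y|v a x y]; apply: qtensP => Z f hf; rewrite qtlift_linear // !qtlift_tmk //.
  exact: hf.1.
exact: hf.2.
Qed.

Lemma qtens_sum (x : qtensor) : x = \sum_(p <- qtrepr x) qtmk p.1 p.2.
Proof.
apply: qtensP => Z f hf; rewrite {1}/qtlift /fsum.
elim: (qtrepr x) => [|p s IH]; first by rewrite !big_nil; apply/esym/qtlift_zero.
by rewrite !big_cons qtlift_add // qtlift_tmk // IH.
Qed.

End TensorConstruction.

Record tensor_product (K : fieldType) (V W : lmodType K) := TensorProduct {
  tens_mod :> lmodType K;
  tmk_of : V -> W -> tens_mod;
  trepr_of : tens_mod -> seq (V * W);
  tmk_of_bilin : bilin tmk_of;
  trepr_of_sum : forall x, x = \sum_(p <- trepr_of x) tmk_of p.1 p.2;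
  tens_univ : forall (Z : lmodType K) (f : V -> W -> Z), bilin f ->
    linear (fun x => fsum f (trepr_of x)) /\
    (forall v w, fsum f (trepr_of (tmk_of v w)) = f v w) }.

(* Opaque: only the universal property and a choice of representatives are used. *)
Definition tensor_pkg (K : fieldType) (V W : lmodType K) : tensor_product V W.
Proof.
refine (@TensorProduct K V W (qtensor V W) (@qtmk K V W) (@qtrepr K V W)
  (@qtmk_bilin K V W) (@qtens_sum K V W) _).
by move=> Z f hf; split; [exact: qtlift_linear|move=> v w; exact: qtlift_tmk].
Qed.

Section Tensor.
Variables (K : fieldType) (V W : lmodType K).

Definition tensor : lmodType K := tensor_pkg V W.
Definition tmk (v : V) (w : W) : tensor := tmk_of (tensor_pkg V W) v w.
Definition trepr (x : tensor) : seq (V * W) := trepr_of x.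
(* Linear extension of a bilinear f. It is computed on a chosen representative,
   hence only meaningful when [bilin f]. *)
Definition tlift (Z : lmodType K) (f : V -> W -> Z) (x : tensor) : Z :=
  \sum_(p <- trepr x) f p.1 p.2.

Lemma tmk_bilin : bilin tmk.
Proof. exact: tmk_of_bilin. Qed.

Lemma tens_sum (x : tensor) : x = \sum_(p <- trepr x) tmk p.1 p.2.
Proof. exact: trepr_of_sum. Qed.

Lemma tlift_linear (Z : lmodType K) (f : V -> W -> Z) : bilin f -> linear (tlift f).
Proof. by move=> hf; case: (tens_univ (tensor_pkg V W) hf). Qed.

Lemma tlift_tmk (Z : lmodType K) (f : V -> W -> Z) v w :
  bilin f -> tlift f (tmk v w) = f v w.
Proof. by move=> hf; case: (tens_univ (tensor_pkg V W) hf) => _; apply. Qed.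

Lemma tens_ext (Z : lmodType K) (f g : tensor -> Z) : linear f -> linear g ->
  (forall v w, f (tmk v w) = g (tmk v w)) -> f =1 g.
Proof.
move=> hf hg h x; rewrite [x]tens_sum.
have l0 (u : tensor -> Z) : linear u -> u 0 = 0.
  by move=> hu; have := hu (-1) 0 0; rewrite scaler0 add0r scaleN1r addNr.
elim: (trepr x) => [|p s IH]; first by rewrite !big_nil !l0.
by rewrite !big_cons -[tmk _ _]scale1r hf hg IH h.
Qed.

End Tensor.


Section TensorTheory.
Variable K : fieldType.
Implicit Types U V W Z : lmodType K.

Definition mklin V W (f : V -> W) (hf : linear f) : {linear V -> W} :=
  HB.pack f (GRing.isLinear.Build K V W *:%R f hf).

Lemma lin_ext V W (f g : {linear V -> W}) : f =1 g -> f = g.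
Proof.
case: f g => [f [[f1] [f2]]] [g [[g1] [g2]]] /= /funext fg.
by case: g / fg g1 g2 => g1 g2; rewrite (Prop_irrelevance f1 g1) (Prop_irrelevance f2 g2).
Qed.

Lemma tmkP V W (w : W) a (x y : V) :
  tmk (a *: x + y) w = a *: tmk x w + tmk y w.
Proof. exact: (tmk_bilin V W).1. Qed.
Lemma tmkPr V W (v : V) a (x y : W) :
  tmk v (a *: x + y) = a *: tmk v x + tmk v y.
Proof. exact: (tmk_bilin V W).2. Qed.

Lemma bilinDl V W Z (f : V -> W -> Z) : bilin f -> forall x y w, f (x + y) w = f x w + f y w.
Proof. by case=> h _ x y w; have := h w 1 x y; rewrite !scale1r. Qed.
Lemma bilinDr V W Z (f : V -> W -> Z) : bilin f -> forall v x y, f v (x + y) = f v x + f v y.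
Proof. by case=> _ h v x y; have := h v 1 x y; rewrite !scale1r. Qed.
Lemma bilin_Zl V W Z (f : V -> W -> Z) : bilin f -> forall a v w, f (a *: v) w = a *: f v w.
Proof. by move=> hf a v w; rewrite bilinZl. Qed.
Lemma bilin_Zr V W Z (f : V -> W -> Z) : bilin f -> forall a v w, f v (a *: w) = a *: f v w.
Proof.
case=> _ h a v w; rewrite -[RHS]addr0 -[in LHS](addr0 (a *: w)) h; congr (_ + _).
by have := h v (-1) 0 0; rewrite scaler0 add0r scaleN1r addNr.
Qed.

Definition tmkDl V W := bilinDl (tmk_bilin V W).
Definition tmkDr V W := bilinDr (tmk_bilin V W).
Definition tmkZl V W := bilin_Zl (tmk_bilin V W).
Definition tmkZr V W := bilin_Zr (tmk_bilin V W).

Lemma tens_ind V W (P : tensor V W -> Prop) :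
  (forall v w, P (tmk v w)) -> (forall x y, P x -> P y -> P (x + y)) ->
  forall x, P x.
Proof.
move=> h1 hD x; rewrite [x]tens_sum; elim: (trepr x) => [|p s IH].
  by rewrite big_nil -(scale0r (tmk 0 0)) -tmkZl scale0r; apply: h1.
by rewrite big_cons; apply: hD.
Qed.

Lemma tliftD V W Z (f : V -> W -> Z) : bilin f -> forall x y, tlift f (x + y) = tlift f x + tlift f y.
Proof. by move=> hf x y; have := tlift_linear hf 1 x y; rewrite !scale1r. Qed.
Lemma tliftZ V W Z (f : V -> W -> Z) : bilin f -> forall a x, tlift f (a *: x) = a *: tlift f x.
Proof.
move=> hf a x; have l0 : tlift f 0 = 0.
  by have := tlift_linear hf (-1) 0 0; rewrite scaler0 add0r scaleN1r addNr.
by have := tlift_linear hf a x 0; rewrite !addr0 l0 addr0.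
Qed.
Lemma tlift_funP V W Z (h f g : V -> W -> Z) a x :
  (forall v w, h v w = a *: f v w + g v w) -> tlift h x = a *: tlift f x + tlift g x.
Proof.
move=> e; rewrite /tlift scaler_sumr -big_split /=.
by apply: eq_bigr => p _; rewrite e.
Qed.
Lemma eq_tlift V W Z (f g : V -> W -> Z) x : (forall v w, f v w = g v w) -> tlift f x = tlift g x.
Proof. by move=> e; apply: eq_bigr => p _; rewrite e. Qed.

Definition tmap V V' W W' (f : V -> V') (g : W -> W') : tensor V W -> tensor V' W' :=
  tlift (fun v w => tmk (f v) (g w)).

Lemma tmap_bilin V V' W W' (f : {linear V -> V'}) (g : {linear W -> W'}) :
  bilin (fun v w => tmk (f v) (g w)).
Proof. by split=> [w a x y|v a x y] /=; rewrite linearP ?tmkP ?tmkPr. Qed.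

HB.instance Definition _ V V' W W' (f : {linear V -> V'}) (g : {linear W -> W'}) :=
  GRing.isLinear.Build K (tensor V W) (tensor V' W') *:%R (tmap f g)
    (tlift_linear (tmap_bilin f g)).

Lemma tmapE V V' W W' (f : {linear V -> V'}) (g : {linear W -> W'}) v w :
  tmap f g (tmk v w) = tmk (f v) (g w).
Proof. exact/(tlift_tmk v w (tmap_bilin f g)). Qed.

(* (a (x) b, v (x) w) |-> f a v (x) g b w *)
Definition tens2 U U' V V' Z Z' (f : U -> V -> Z) (g : U' -> V' -> Z')
    (d : tensor U U') (x : tensor V V') : tensor Z Z' :=
  tlift (fun a b => tlift (fun v w => tmk (f a v) (g b w)) x) d.

Section Tens2.
Variables (U U' V V' Z Z' : lmodType K) (f : U -> V -> Z) (g : U' -> V' -> Z').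
Hypotheses (hf : bilin f) (hg : bilin g).

Let in_bilin a b : bilin (fun v w => tmk (f a v) (g b w)).
Proof. by split=> [w c x y|v c x y] /=; rewrite ?(hf.2) ?(hg.2) ?tmkP ?tmkPr. Qed.
Let out_bilin x : bilin (fun a b => tlift (fun v w => tmk (f a v) (g b w)) x).
Proof.
split=> [b c y z|a c y z] /=; apply: tlift_funP => v w.
  by rewrite (hf.1) tmkP.
by rewrite (hg.1) tmkPr.
Qed.

Lemma tens2E a b v w : tens2 f g (tmk a b) (tmk v w) = tmk (f a v) (g b w).
Proof. by rewrite /tens2 tlift_tmk // tlift_tmk. Qed.

Lemma tens2_bilin : bilin (tens2 f g).
Proof.
split=> [x c d e|d c x y]; first exact: tlift_linear.
by apply: tlift_funP => v w; apply: tlift_linear.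
Qed.
End Tens2.

Lemma assoc_in U V W (w : W) : bilin (fun (u : U) (v : V) => tmk u (tmk v w)).
Proof. by split=> [u a x y|v a x y] /=; rewrite ?tmkP ?tmkPr. Qed.
Lemma assoc_out U V W :
  bilin (fun (x : tensor U V) (w : W) => tlift (fun u v => tmk u (tmk v w)) x).
Proof.
split=> [w|x a w w']; first exact: tlift_linear (assoc_in _ _ w).
by apply: tlift_funP => u v; rewrite !tmkPr.
Qed.
Lemma assocV_in U V W (u : U) : bilin (fun (v : V) (w : W) => tmk (tmk u v) w).
Proof. by split=> [w a x y|v a x y] /=; rewrite ?tmkP ?tmkPr ?tmkP. Qed.
Lemma assocV_out U V W :
  bilin (fun (u : U) (x : tensor V W) => tlift (fun v w => tmk (tmk u v) w) x).
Proof.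
split=> [x a u u'|u]; last exact: tlift_linear (assocV_in _ _ u).
by apply: tlift_funP => v w; rewrite !tmkP.
Qed.

Definition tassoc U V W : tensor (tensor U V) W -> tensor U (tensor V W) :=
  tlift (fun x w => tlift (fun u v => tmk u (tmk v w)) x).
HB.instance Definition _ U V W := GRing.isLinear.Build K _ _ *:%R
  (@tassoc U V W) (tlift_linear (assoc_out U V W)).

Definition tassocV U V W : tensor U (tensor V W) -> tensor (tensor U V) W :=
  tlift (fun u x => tlift (fun v w => tmk (tmk u v) w) x).
HB.instance Definition _ U V W := GRing.isLinear.Build K _ _ *:%R
  (@tassocV U V W) (tlift_linear (assocV_out U V W)).

Lemma tassocE U V W (u : U) (v : V) (w : W) :
  tassoc (tmk (tmk u v) w) = tmk u (tmk v w).
Proof.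
rewrite /tassoc /= tlift_tmk; last exact: assoc_out.
by rewrite tlift_tmk //; apply: assoc_in.
Qed.
Lemma tassocVE U V W (u : U) (v : V) (w : W) :
  tassocV (tmk u (tmk v w)) = tmk (tmk u v) w.
Proof.
rewrite /tassocV /= tlift_tmk; last exact: assocV_out.
by rewrite tlift_tmk //; apply: assocV_in.
Qed.

Lemma scale_bilin V : bilin (fun (a : K^o) (v : V) => a *: v).
Proof.
split=> [v a x y|b a x y] /=; first by rewrite scalerDl scalerA.
by rewrite scalerDr !scalerA mulrC.
Qed.
Lemma scaler_bilin V : bilin (fun (v : V) (a : K^o) => a *: v).
Proof. by case: (scale_bilin V) => h h'; split. Qed.

Definition tlunit V : tensor K^o V -> V := tlift (fun (a : K^o) (v : V) => (a : K) *: v).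
HB.instance Definition _ V := GRing.isLinear.Build K _ _ *:%R
  (@tlunit V) (tlift_linear (scale_bilin V)).

Definition trunit V : tensor V K^o -> V := tlift (fun (v : V) (a : K^o) => (a : K) *: v).
HB.instance Definition _ V := GRing.isLinear.Build K _ _ *:%R
  (@trunit V) (tlift_linear (scaler_bilin V)).

Definition tlunitV V (v : V) : tensor K^o V := tmk (1 : K^o) v.
HB.instance Definition _ V := GRing.isLinear.Build K _ _ *:%R
  (@tlunitV V) ((tmk_bilin K^o V).2 1).

Definition trunitV V (v : V) : tensor V K^o := tmk v (1 : K^o).
HB.instance Definition _ V := GRing.isLinear.Build K _ _ *:%R
  (@trunitV V) ((tmk_bilin V K^o).1 1).

Lemma tlunitE V (a : K^o) (v : V) : tlunit (tmk a v) = a *: v.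
Proof. exact: (tlift_tmk a v (scale_bilin V)). Qed.
Lemma trunitE V (a : K^o) (v : V) : trunit (tmk v a) = a *: v.
Proof. exact: (tlift_tmk v a (scaler_bilin V)). Qed.

Definition tensD := (tmkDl, tmkDr).
End TensorTheory.


Arguments tmap : simpl never.
Arguments tassoc : simpl never.
Arguments tassocV : simpl never.
Arguments tlunit : simpl never.
Arguments trunit : simpl never.

Record category := Category {
  Ob :> Type;
  Hom : Ob -> Ob -> Type;
  idc : forall X, Hom X X;
  compc : forall X Y Z, Hom Y Z -> Hom X Y -> Hom X Z;
  comp1c : forall X Y (f : Hom X Y), compc (idc Y) f = f;
  compc1 : forall X Y (f : Hom X Y), compc f (idc X) = f;
  compcA : forall X Y Z T (h : Hom Z T) (g : Hom Y Z) (f : Hom X Y),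
    compc (compc h g) f = compc h (compc g f) }.
Arguments Hom {c} X Y.
Arguments idc {c} X.
Notation "g \oc f" := (compc g f) (at level 40, left associativity).

Record functor (B A : category) := Functor {
  fob :> B -> A;
  fhom : forall X Y : B, Hom X Y -> Hom (fob X) (fob Y);
  fhom1 : forall X, fhom (idc X) = idc (fob X);
  fhomM : forall X Y Z (g : Hom Y Z) (f : Hom X Y), fhom (g \oc f) = fhom g \oc fhom f }.

Definition separable_functor (B A : category) (U : functor B A) : Prop :=
  exists P : forall X Y : B, Hom (U X) (U Y) -> Hom X Y,
    (forall (X X' Y Y' : B) (f : Hom X' X) (g : Hom Y Y') (h : Hom (U X) (U Y)),
       P X' Y' (fhom U g \oc h \oc fhom U f) = g \oc P X Y h \oc f) /\
    (forall (X Y : B) (f : Hom X Y), P X Y (fhom U f) = f).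

Definition has_section (B : category) (X Y : B) (f : Hom X Y) : Prop :=
  exists s : Hom Y X, f \oc s = idc Y.

(* E_G-projectivity of P, for E_G the morphisms f with G(f) split epi *)
Definition relprojective (B A : category) (G : functor B A) (P : B) : Prop :=
  forall (X Y : B) (f : Hom X Y), has_section (fhom G f) ->
  forall g : Hom P Y, exists g' : Hom P X, f \oc g' = g.

Record monoidal := Monoidal {
  moncat :> category;
  mten : moncat -> moncat -> moncat;
  mtenm : forall X X' Y Y' : moncat, Hom X X' -> Hom Y Y' ->
    Hom (mten X Y) (mten X' Y');
  munit : moncat;
  massoc : forall X Y Z, Hom (mten (mten X Y) Z) (mten X (mten Y Z));
  massocV : forall X Y Z, Hom (mten X (mten Y Z)) (mten (mten X Y) Z);
  mlunit : forall X, Hom (mten munit X) X;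
  mlunitV : forall X, Hom X (mten munit X);
  mrunit : forall X, Hom (mten X munit) X;
  mrunitV : forall X, Hom X (mten X munit);
  mten1 : forall X Y, mtenm (idc X) (idc Y) = idc (mten X Y);
  mtenM : forall X X' X'' Y Y' Y'' (f' : Hom X' X'') (f : Hom X X')
      (g' : Hom Y' Y'') (g : Hom Y Y'),
    mtenm (f' \oc f) (g' \oc g) = mtenm f' g' \oc mtenm f g;
  massocK : forall X Y Z, massocV X Y Z \oc massoc X Y Z = idc _;
  massocVK : forall X Y Z, massoc X Y Z \oc massocV X Y Z = idc _;
  mlunitK : forall X, mlunitV X \oc mlunit X = idc _;
  mlunitVK : forall X, mlunit X \oc mlunitV X = idc _;
  mrunitK : forall X, mrunitV X \oc mrunit X = idc _;
  mrunitVK : forall X, mrunit X \oc mrunitV X = idc _;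
  massoc_nat : forall X X' Y Y' Z Z' (f : Hom X X') (g : Hom Y Y') (h : Hom Z Z'),
    massoc X' Y' Z' \oc mtenm (mtenm f g) h = mtenm f (mtenm g h) \oc massoc X Y Z;
  mlunit_nat : forall X X' (f : Hom X X'),
    mlunit X' \oc mtenm (idc munit) f = f \oc mlunit X;
  mrunit_nat : forall X X' (f : Hom X X'),
    mrunit X' \oc mtenm f (idc munit) = f \oc mrunit X;
  mpentagon : forall X Y Z T,
    massoc X Y (mten Z T) \oc massoc (mten X Y) Z T =
    mtenm (idc X) (massoc Y Z T) \oc massoc X (mten Y Z) T
      \oc mtenm (massoc X Y Z) (idc T);
  mtriangle : forall X Y,
    mtenm (idc X) (mlunit Y) \oc massoc X munit Y = mtenm (mrunit X) (idc Y) }.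
Arguments mten {m} X Y.
Arguments mtenm {m X X' Y Y'} f g.
Arguments munit m : clear implicits.
Arguments massoc {m} X Y Z.
Arguments massocV {m} X Y Z.
Arguments mlunit {m} X.
Arguments mlunitV {m} X.
Arguments mrunit {m} X.
Arguments mrunitV {m} X.
Notation "X \ox Y" := (mten X Y) (at level 38, left associativity).
Notation "f \om g" := (mtenm f g) (at level 38, left associativity).

Section Coherence.
Variable M : monoidal.
Implicit Types X Y Z T : M.

Lemma mtenl X Y Y' Y'' (g : Hom Y' Y'') (f : Hom Y Y') :
  idc X \om (g \oc f) = (idc X \om g) \oc (idc X \om f).
Proof. by rewrite -mtenM comp1c. Qed.
Lemma mtenr X Y Y' Y'' (g : Hom Y' Y'') (f : Hom Y Y') :
  (g \oc f) \om idc X = (g \om idc X) \oc (f \om idc X).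
Proof. by rewrite -mtenM comp1c. Qed.

Lemma cancel_epi X Y Z (f g : Hom Y Z) (e : Hom X Y) (e' : Hom Y X) :
  e \oc e' = idc Y -> f \oc e = g \oc e -> f = g.
Proof. by move=> h k; rewrite -[f]compc1 -[g]compc1 -h -!compcA k. Qed.
Lemma cancel_mono X Y Z (f g : Hom X Y) (e : Hom Y Z) (e' : Hom Z Y) :
  e' \oc e = idc Y -> e \oc f = e \oc g -> f = g.
Proof. by move=> h k; rewrite -[f]comp1c -[g]comp1c -h !compcA k. Qed.

Lemma munitl_inj X Y (f g : Hom X Y) :
  idc (munit M) \om f = idc (munit M) \om g -> f = g.
Proof.
move=> h; apply: (cancel_epi (mlunitVK X)).
by rewrite -!mlunit_nat h.
Qed.
Lemma munitr_inj X Y (f g : Hom X Y) :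
  f \om idc (munit M) = g \om idc (munit M) -> f = g.
Proof.
move=> h; apply: (cancel_epi (mrunitVK X)).
by rewrite -!mrunit_nat h.
Qed.

Lemma mlunit_ten X Y :
  mlunit (X \ox Y) \oc massoc (munit M) X Y = mlunit X \om idc Y.
Proof.
apply: munitl_inj; set I := munit M.
apply: (cancel_epi (e := massoc I (I \ox X) Y) (massocVK _ _ _)).
apply: (cancel_epi (e := massoc I I X \om idc Y) (e' := massocV I I X \om idc Y)).
  by rewrite -mtenr massocVK mten1.
have := mpentagon I I X Y; rewrite mtenl !compcA => <-.
rewrite -[LHS]compcA mtriangle -[RHS]compcA -massoc_nat compcA -mtenr mtriangle.
by rewrite massoc_nat mten1.
Qed.

Lemma mrunit_ten X Y :
  (idc X \om mrunit Y) \oc massoc X Y (munit M) = mrunit (X \ox Y).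
Proof.
apply: munitr_inj; set I := munit M.
apply: (cancel_mono (e := massoc X Y I) (massocK _ _ _)).
rewrite mtenr -compcA massoc_nat compcA -(mtriangle (X \ox Y) I).
rewrite -(mtriangle Y I) mtenl -(mten1 X Y) -[RHS]compcA massoc_nat !compcA.
by have := mpentagon X Y I I; rewrite !compcA => ->.
Qed.
End Coherence.

Section Algebras.
Variable M : monoidal.

Record algebra_in := AlgebraIn {
  algob :> M;
  amul : Hom (algob \ox algob) algob;
  aone : Hom (munit M) algob;
  amulA : amul \oc (amul \om idc algob) =
          amul \oc (idc algob \om amul) \oc massoc algob algob algob;
  amul1l : amul \oc (aone \om idc algob) = mlunit algob;
  amul1r : amul \oc (idc algob \om aone) = mrunit algob }.

Record coalgebra_in := CoalgebraIn {
  coalgob :> M;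
  cdelta : Hom coalgob (coalgob \ox coalgob);
  ceps : Hom coalgob (munit M);
  cdeltaA : massoc coalgob coalgob coalgob \oc (cdelta \om idc coalgob) \oc cdelta =
            (idc coalgob \om cdelta) \oc cdelta;
  cdelta1l : mlunit coalgob \oc (ceps \om idc coalgob) \oc cdelta = idc coalgob;
  cdelta1r : mrunit coalgob \oc (idc coalgob \om ceps) \oc cdelta = idc coalgob }.

Section Bimodules.
Variable A : algebra_in.

Record bimodule := Bimodule {
  bimob :> M;
  bl : Hom (A \ox bimob) bimob;
  br : Hom (bimob \ox A) bimob;
  blA : bl \oc (amul A \om idc bimob) = bl \oc (idc A \om bl) \oc massoc A A bimob;
  bl1 : bl \oc (aone A \om idc bimob) = mlunit bimob;
  brA : br \oc (br \om idc A) = br \oc (idc bimob \om amul A) \oc massoc bimob A A;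
  br1 : br \oc (idc bimob \om aone A) = mrunit bimob;
  blr : br \oc (bl \om idc A) = bl \oc (idc A \om br) \oc massoc A bimob A }.

Definition is_bimod_hom (X Y : bimodule) (f : Hom (X : M) Y) : Prop :=
  f \oc bl X = bl Y \oc (idc A \om f) /\ f \oc br X = br Y \oc (f \om idc A).

Definition bimod_hom (X Y : bimodule) : Type := {f : Hom (X : M) Y | is_bimod_hom f}.

Lemma bimod_id_subproof (X : bimodule) : is_bimod_hom (idc (X : M)).
Proof. by split; rewrite mten1 comp1c compc1. Qed.

Lemma bimod_comp_subproof (X Y Z : bimodule) (g : bimod_hom Y Z) (f : bimod_hom X Y) :
  is_bimod_hom (sval g \oc sval f).
Proof.
case: g f => [g [gl gr]] [f [fl fr]]; split=> /=.
  by rewrite compcA fl -compcA gl mtenl !compcA.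
by rewrite compcA fr -compcA gr mtenr !compcA.
Qed.

Definition bimod_cat : category.
Proof.
refine (@Category bimodule bimod_hom (fun X => exist _ _ (bimod_id_subproof X))
  (fun X Y Z g f => exist _ _ (bimod_comp_subproof g f)) _ _ _).
- by move=> X Y [f hf]; apply: eq_exist; rewrite /= comp1c.
- by move=> X Y [f hf]; apply: eq_exist; rewrite /= compc1.
- by move=> X Y Z T [h ?] [g ?] [f ?]; apply: eq_exist; rewrite /= compcA.
Defined.

Definition regular_bimod : bimod_cat :=
  @Bimodule A (amul A) (amul A) (amulA A) (amul1l A) (amulA A) (amul1r A) (amulA A).

Lemma massocV_nat (X X' Y Y' Z Z' : M) (f : Hom X X') (g : Hom Y Y') (h : Hom Z Z') :
  massocV X' Y' Z' \oc (f \om (g \om h)) = (f \om g \om h) \oc massocV X Y Z.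
Proof.
apply: (cancel_mono (e := massoc _ _ _)); first exact: massocK.
rewrite -!compcA massocVK comp1c massoc_nat !compcA massocVK compc1 //.
Qed.

Lemma free_bimod_subproof :
  let X := A \ox A in
  let l := (amul A \om idc A) \oc massocV A A A in
  let r := (idc A \om amul A) \oc massoc A A A in
  [/\ l \oc (amul A \om idc X) = l \oc (idc A \om l) \oc massoc A A X,
      l \oc (aone A \om idc X) = mlunit X,
      r \oc (r \om idc A) = r \oc (idc X \om amul A) \oc massoc X A A,
      r \oc (idc X \om aone A) = mrunit X
    & r \oc (l \om idc A) = l \oc (idc A \om r) \oc massoc A X A].
Proof.
move=> X l r; rewrite /l /r /X {X l r}; split.
- have pent : massocV A (A \ox A) A \oc (idc A \om massocV A A A) \oc massoc A A (A \ox A) =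
    (massoc A A A \om idc A) \oc massocV (A \ox A) A A.
    apply: (cancel_mono (e := massoc A (A \ox A) A)); first exact: massocK.
    apply: (cancel_mono (e := idc A \om massoc A A A) (e' := idc A \om massocV A A A)).
      by rewrite -mtenl massocK mten1.
    apply: (cancel_epi (e := massoc (A \ox A) A A)); first exact: massocVK.
    rewrite !compcA massocK compc1 -[massoc A (A \ox A) A \oc (massocV _ _ _ \oc _)]compcA.
    rewrite massocVK comp1c -[LHS]compcA -mtenl massocVK mten1 comp1c.
    by rewrite mpentagon compcA.
  rewrite -(mten1 A A) compcA massocV_nat mtenl !compcA.
  rewrite -[massocV _ _ _ \oc ((idc A \om (amul A \om _)) \oc _)]compcA massocV_nat. 
  rewrite [in RHS]compcA -[massocV _ _ _ \oc (_ \oc _)]compcA pent.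
  by rewrite -!compcA -!mtenr amulA !compcA.
- rewrite -(mten1 A A) compcA massocV_nat -compcA -mtenr amul1l.
  by rewrite -mlunit_ten compcA massocVK compc1.
- rewrite mtenr !compcA -[massoc _ _ _ \oc (_ \oc _)]compcA massoc_nat.
  rewrite !compcA -[_ \oc (_ \oc (massoc _ _ _ \oc _))]compcA -mtenl amulA.
  rewrite -[massoc A A A \oc ((idc _ \om _) \oc _)]compcA -[in RHS](mten1 A A) massoc_nat.
  rewrite !compcA mpentagon -!compcA -!mtenl; congr (_ \oc _ \oc _).
- rewrite -mrunit_ten -(mten1 A A) compcA massoc_nat -compcA -mtenl; by rewrite amul1r.
- apply: (cancel_epi (e := massoc A A A \om idc A) (e' := massocV A A A \om idc A)).
    by rewrite -mtenr massocVK mten1.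
  rewrite !compcA -mtenr !compcA massocK compc1 massoc_nat mtenl.
  have := mpentagon A A A A; rewrite !compcA => pent.
  rewrite -pent -[massocV _ _ _ \oc (_ \oc _)]compcA massocV_nat.
  rewrite [in RHS]compcA -[massocV _ _ _ \oc (_ \oc _)]compcA massocK comp1c mten1.
  by rewrite -!compcA -!mtenM !comp1c !compc1.
Qed.

(* A (x) A *)
Definition free_bimod : bimod_cat.
Proof.
refine (@Bimodule (A \ox A) ((amul A \om idc A) \oc massocV A A A)
  ((idc A \om amul A) \oc massoc A A A) _ _ _ _ _); by case: free_bimod_subproof.
Defined.

Lemma mul_bimod_subproof : @is_bimod_hom free_bimod regular_bimod (amul A).
Proof.
split=> /=.
  by rewrite -compcA amulA compcA massocVK compc1.
by rewrite amulA compcA.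
Qed.

Definition mul_bimod : Hom free_bimod regular_bimod := exist _ (amul A) mul_bimod_subproof.

Definition separable_algebra : Prop := has_section mul_bimod.

End Bimodules.

Section Comodules.
Variable C : coalgebra_in.

Record lcomodule := Lcomodule {
  lcomob :> M;
  lco : Hom lcomob (C \ox lcomob);
  lcoA : massoc C C lcomob \oc (cdelta C \om idc lcomob) \oc lco = (idc C \om lco) \oc lco;
  lco1 : mlunit lcomob \oc (ceps C \om idc lcomob) \oc lco = idc lcomob }.

Definition is_lcomod_hom (X Y : lcomodule) (f : Hom (X : M) Y) : Prop :=
  lco Y \oc f = (idc C \om f) \oc lco X.

Definition lcomod_hom (X Y : lcomodule) : Type := {f : Hom (X : M) Y | is_lcomod_hom f}.

Lemma lcomod_id_subproof (X : lcomodule) : is_lcomod_hom (idc (X : M)).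
Proof. by rewrite /is_lcomod_hom mten1 comp1c compc1. Qed.

Lemma lcomod_comp_subproof (X Y Z : lcomodule) (g : lcomod_hom Y Z) (f : lcomod_hom X Y) :
  is_lcomod_hom (sval g \oc sval f).
Proof.
case: g f => [g hg] [f hf]; rewrite /is_lcomod_hom /=.
by rewrite -compcA hg compcA hf mtenl !compcA.
Qed.

Definition lcomod_cat : category.
Proof.
refine (@Category lcomodule lcomod_hom (fun X => exist _ _ (lcomod_id_subproof X))
  (fun X Y Z g f => exist _ _ (lcomod_comp_subproof g f)) _ _ _).
- by move=> X Y [f hf]; apply: eq_exist; rewrite /= comp1c.
- by move=> X Y [f hf]; apply: eq_exist; rewrite /= compc1.
- by move=> X Y Z T [h ?] [g ?] [f ?]; apply: eq_exist; rewrite /= compcA.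
Defined.

Record bicomodule := Bicomodule {
  bicomob :> M;
  bcl : Hom bicomob (C \ox bicomob);
  bcr : Hom bicomob (bicomob \ox C);
  bclA : massoc C C bicomob \oc (cdelta C \om idc bicomob) \oc bcl = (idc C \om bcl) \oc bcl;
  bcl1 : mlunit bicomob \oc (ceps C \om idc bicomob) \oc bcl = idc bicomob;
  bcrA : massoc bicomob C C \oc (bcr \om idc C) \oc bcr = (idc bicomob \om cdelta C) \oc bcr;
  bcr1 : mrunit bicomob \oc (idc bicomob \om ceps C) \oc bcr = idc bicomob;
  bclr : massoc C bicomob C \oc (bcl \om idc C) \oc bcr = (idc C \om bcr) \oc bcl }.

Definition is_bicomod_hom (X Y : bicomodule) (f : Hom (X : M) Y) : Prop :=
  bcl Y \oc f = (idc C \om f) \oc bcl X /\ bcr Y \oc f = (f \om idc C) \oc bcr X.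

Definition bicomod_hom (X Y : bicomodule) : Type := {f : Hom (X : M) Y | is_bicomod_hom f}.

Lemma bicomod_id_subproof (X : bicomodule) : is_bicomod_hom (idc (X : M)).
Proof. by split; rewrite mten1 comp1c compc1. Qed.

Lemma bicomod_comp_subproof (X Y Z : bicomodule) (g : bicomod_hom Y Z) (f : bicomod_hom X Y) :
  is_bicomod_hom (sval g \oc sval f).
Proof.
case: g f => [g [gl gr]] [f [fl fr]]; split=> /=.
  by rewrite -compcA gl compcA fl mtenl !compcA.
by rewrite -compcA gr compcA fr mtenr !compcA.
Qed.

Definition bicomod_cat : category.
Proof.
refine (@Category bicomodule bicomod_hom (fun X => exist _ _ (bicomod_id_subproof X))
  (fun X Y Z g f => exist _ _ (bicomod_comp_subproof g f)) _ _ _).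
- by move=> X Y [f hf]; apply: eq_exist; rewrite /= comp1c.
- by move=> X Y [f hf]; apply: eq_exist; rewrite /= compc1.
- by move=> X Y Z T [h ?] [g ?] [f ?]; apply: eq_exist; rewrite /= compcA.
Defined.

End Comodules.
End Algebras.

Section Vect.
Variable K : fieldType.

Definition vect_cat : category.
Proof.
refine (@Category (lmodType K) (fun V W => {linear V -> W}) (fun V => idfun : {linear V -> V})
  (fun U V W (g : {linear V -> W}) (f : {linear U -> V}) => (g \o f : {linear U -> W})) _ _ _);
by move=> *; apply: lin_ext.
Defined.

Lemma tens3_ind (U V W : lmodType K) (P : tensor (tensor U V) W -> Prop) :
  (forall u v w, P (tmk (tmk u v) w)) -> (forall x y, P x -> P y -> P (x + y)) ->
  forall x, P x.
Proof.
move=> h hD; apply: tens_ind => // x w; move: x.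
by apply: tens_ind => // x y hx hy; rewrite tmkDl; apply: hD.
Qed.

Lemma tens3_indr (U V W : lmodType K) (P : tensor U (tensor V W) -> Prop) :
  (forall u v w, P (tmk u (tmk v w))) -> (forall x y, P x -> P y -> P (x + y)) ->
  forall x, P x.
Proof.
move=> h hD; apply: tens_ind => // u; 
by apply: tens_ind => // x y hx hy; rewrite tmkDr; apply: hD.
Qed.

Lemma tens4_ind (U V W X : lmodType K) (P : tensor (tensor (tensor U V) W) X -> Prop) :
  (forall u v w x, P (tmk (tmk (tmk u v) w) x)) -> (forall x y, P x -> P y -> P (x + y)) ->
  forall x, P x.
Proof.
move=> h hD; apply: tens_ind => // x w; move: x.
by apply: tens3_ind => // x y hx hy; rewrite tmkDl; apply: hD.
Qed.


Implicit Types U V W X : lmodType K.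

Lemma vect_ten1 V W : tmap (idfun : {linear V -> V}) (idfun : {linear W -> W}) =1 idfun.
Proof.
apply: tens_ind => [v w|x y hx hy]; first by rewrite tmapE.
by rewrite linearD /= hx hy.
Qed.

Lemma vect_tenM (X X' X'' Y Y' Y'' : lmodType K) (f' : {linear X' -> X''}) (f : {linear X -> X'})
    (g' : {linear Y' -> Y''}) (g : {linear Y -> Y'}) :
  tmap (f' \o f) (g' \o g) =1 tmap f' g' \o tmap f g.
Proof.
apply: tens_ind => [v w|x y hx hy] /=; first by rewrite !tmapE.
by rewrite !linearD /= hx hy.
Qed.

Lemma vect_assocK U V W : cancel (@tassoc K U V W) (@tassocV K U V W).
Proof.
apply: tens3_ind => [u v w|x y hx hy]; first by rewrite tassocE tassocVE.
by rewrite !linearD /= hx hy.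
Qed.

Lemma vect_assocVK U V W : cancel (@tassocV K U V W) (@tassoc K U V W).
Proof.
apply: tens3_indr => [u v w|x y hx hy]; first by rewrite tassocVE tassocE.
by rewrite !linearD /= hx hy.
Qed.

Lemma vect_lunitK V : cancel (@tlunit K V) (@tlunitV K V).
Proof.
apply: tens_ind => [a v|x y hx hy].
  by rewrite tlunitE /tlunitV tmkZr -tmkZl /GRing.scale /= mulr1.
by rewrite !linearD /= hx hy.
Qed.

Lemma vect_lunitVK V : cancel (@tlunitV K V) (@tlunit K V).
Proof. by move=> v; rewrite tlunitE scale1r. Qed.

Lemma vect_runitK V : cancel (@trunit K V) (@trunitV K V).
Proof.
apply: tens_ind => [v a|x y hx hy].
  by rewrite trunitE /trunitV tmkZl -tmkZr /GRing.scale /= mulr1.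
by rewrite !linearD /= hx hy.
Qed.

Lemma vect_runitVK V : cancel (@trunitV K V) (@trunit K V).
Proof. by move=> v; rewrite trunitE scale1r. Qed.

Lemma vect_assoc_nat (U U' V V' W W' : lmodType K) (f : {linear U -> U'}) (g : {linear V -> V'})
    (h : {linear W -> W'}) x :
  tassoc (tmap (tmap f g) h x) = tmap f (tmap g h) (tassoc x).
Proof.
elim/tens3_ind: x => [u v w|x y hx hy]; first by do 4?[rewrite !(tmapE, tassocE) /=].
by rewrite !linearD /= hx hy.
Qed.

Lemma vect_lunit_nat (V V' : lmodType K) (f : {linear V -> V'}) x :
  tlunit (tmap (idfun : {linear K^o -> K^o}) f x) = f (tlunit x).
Proof.
elim/tens_ind: x => [a v|x y hx hy]; first by rewrite !(tmapE, tlunitE) linearZ.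
by rewrite !linearD /= hx hy.
Qed.

Lemma vect_runit_nat (V V' : lmodType K) (f : {linear V -> V'}) x :
  trunit (tmap f (idfun : {linear K^o -> K^o}) x) = f (trunit x).
Proof.
elim/tens_ind: x => [v a|x y hx hy]; first by rewrite !(tmapE, trunitE) linearZ.
by rewrite !linearD /= hx hy.
Qed.

Lemma vect_pentagon U V W X x :
  tassoc (tassoc x) =
  tmap (idfun : {linear U -> U}) (@tassoc K V W X)
    (tassoc (tmap (@tassoc K U V W) (idfun : {linear X -> X}) x)).
Proof.
elim/tens4_ind: x => [u v w y|x y hx hy]; first by do 4?[rewrite !(tmapE, tassocE) /=].
by rewrite !linearD /= hx hy.
Qed.

Lemma vect_triangle V W x :
  tmap (idfun : {linear V -> V}) (@tlunit K W) (tassoc x) =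
  tmap (@trunit K V) (idfun : {linear W -> W}) x.
Proof.
elim/tens3_ind: x => [v a w|x y hx hy].
  by do 3?[rewrite !(tmapE, tassocE, trunitE, tlunitE) /=]; rewrite tmkZl tmkZr.
by rewrite !linearD /= hx hy.
Qed.

Definition vect : monoidal.
Proof.
refine (@Monoidal vect_cat (fun V W : lmodType K => (tensor V W : lmodType K))
  (fun V V' W W' (f : {linear V -> V'}) (g : {linear W -> W'}) =>
     (tmap f g : {linear tensor V W -> tensor V' W'}))
  (K^o : lmodType K) 
  (fun U V W : lmodType K =>
     (@tassoc K U V W : {linear tensor (tensor U V) W -> tensor U (tensor V W)}))
  (fun U V W : lmodType K =>
     (@tassocV K U V W : {linear tensor U (tensor V W) -> tensor (tensor U V) W}))
  (fun V : lmodType K => (@tlunit K V : {linear tensor K^o V -> V}))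
  (fun V : lmodType K => (@tlunitV K V : {linear V -> tensor K^o V}))
  (fun V : lmodType K => (@trunit K V : {linear tensor V K^o -> V}))
  (fun V : lmodType K => (@trunitV K V : {linear V -> tensor V K^o}))
  _ _ _ _ _ _ _ _ _ _ _ _ _).
- by move=> V W; apply: lin_ext; apply: vect_ten1.
- by move=> X X' X'' Y Y' Y'' f' f g' g; apply: lin_ext; apply: vect_tenM.
- by move=> U V W; apply: lin_ext; apply: vect_assocK.
- by move=> U V W; apply: lin_ext; apply: vect_assocVK.
- by move=> V; apply: lin_ext; apply: vect_lunitK.
- by move=> V; apply: lin_ext; apply: vect_lunitVK.
- by move=> V; apply: lin_ext; apply: vect_runitK.
- by move=> V; apply: lin_ext; apply: vect_runitVK.
- by move=> U U' V V' W W' f g h; apply: lin_ext; apply: vect_assoc_nat.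
- by move=> V V' f; apply: lin_ext; apply: vect_lunit_nat.
- by move=> V V' f; apply: lin_ext; apply: vect_runit_nat.
- by move=> U V W X; apply: lin_ext; apply: vect_pentagon.
- by move=> V W; apply: lin_ext; apply: vect_triangle.
Defined.
End Vect.

(* algType only excludes the zero ring, which is not a Hopf algebra anyway since
   the counit is unital. *)
Record hopf_algebra (K : fieldType) := HopfAlgebra {
  hopf_alg :> algType K;
  hdelta : {linear hopf_alg -> tensor hopf_alg hopf_alg};
  heps : {linear hopf_alg -> K^o};
  hS : {linear hopf_alg -> hopf_alg};
  hdeltaA : forall h, tassoc (tmap hdelta (idfun : {linear hopf_alg -> hopf_alg}) (hdelta h)) =
                      tmap (idfun : {linear hopf_alg -> hopf_alg}) hdelta (hdelta h);
  heps1l : forall h, tlift (fun a b => (heps a : K) *: b) (hdelta h) = h;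
  heps1r : forall h, tlift (fun a b => (heps b : K) *: a) (hdelta h) = h;
  hdeltaM : forall g h, hdelta (g * h) = tens2 *%R *%R (hdelta g) (hdelta h);
  hdelta1 : hdelta 1 = tmk 1 1;
  hepsM : forall g h, heps (g * h) = (heps g : K) * (heps h : K);
  heps1 : heps 1 = 1;
  hSl : forall h, tlift (fun a b => hS a * b) (hdelta h) = (heps h : K) *: 1;
  hSr : forall h, tlift (fun a b => a * hS b) (hdelta h) = (heps h : K) *: 1 }.
Arguments hdelta {K} H : rename.
Arguments heps {K} H : rename.
Arguments hS {K} H : rename.

Section Hopf.
Variables (K : fieldType) (H : hopf_algebra K).

(* f h_1 h_2 h_3, for f trilinear *)
Definition sweedler3 (Z : lmodType K) (f : H -> H -> H -> Z) (h : H) : Z :=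
  tlift (fun x c => tlift (fun a b => f a b c) (hdelta H x)) (hdelta H h).

Definition ad_coinvariant_integral (t : H) : Prop :=
  [/\ forall h : H, h * t = (heps H h : K) *: t,
      sweedler3 (fun a b c => tmk (a * hS H c) b) t = tmk 1 t
    & heps H t = 1].

Lemma hmul_bilin : bilin (fun g h : H => g * h).
Proof.
split=> [h a x y|h a x y] /=; first by rewrite mulrDl scalerAl.
by rewrite mulrDr scalerAr.
Qed.

Definition hmul : tensor H H -> H := tlift (fun g h : H => g * h).
HB.instance Definition _ := GRing.isLinear.Build K (tensor H H) H *:%R hmul (tlift_linear hmul_bilin).

Record hbimod := Hbimod {
  hbimod_mod :> lmodType K;
  lact : H -> hbimod_mod -> hbimod_mod;
  ract : hbimod_mod -> H -> hbimod_mod;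
  lact_bilin : bilin lact;
  ract_bilin : bilin ract;
  lact1 : forall v, lact 1 v = v;
  lactM : forall g h v, lact (g * h) v = lact g (lact h v);
  ract1 : forall v, ract v 1 = v;
  ractM : forall v g h, ract v (g * h) = ract (ract v g) h;
  lractC : forall g v h, ract (lact g v) h = lact g (ract v h) }.

Definition is_hbimod_hom (V W : hbimod) (f : {linear V -> W}) : Prop :=
  (forall h v, f (lact h v) = lact h (f v)) /\ (forall v h, f (ract v h) = ract (f v) h).

Definition hbimod_hom (V W : hbimod) : Type := {f : {linear V -> W} | is_hbimod_hom f}.

Lemma hbimod_id_subproof (V : hbimod) : @is_hbimod_hom V V idfun.
Proof. by []. Qed.

Lemma hbimod_comp_subproof (U V W : hbimod) (g : hbimod_hom V W) (f : hbimod_hom U V) :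
  @is_hbimod_hom U W (sval g \o sval f).
Proof.
case: g f => [g [gl gr]] [f [fl fr]].
by split=> [h v|v h] /=; rewrite ?fl ?gl ?fr ?gr.
Qed.

Definition hbimod_cat : category.
Proof.
refine (@Category hbimod hbimod_hom (fun V => exist _ _ (hbimod_id_subproof V))
  (fun U V W g f => exist _ _ (hbimod_comp_subproof g f)) _ _ _).
- by move=> V W [f hf]; apply: eq_exist; apply: lin_ext.
- by move=> V W [f hf]; apply: eq_exist; apply: lin_ext.
- by move=> X V W Z [h ?] [g ?] [f ?]; apply: eq_exist; apply: lin_ext.
Defined.

Section DiagonalAction.
Variables V W : hbimod.

(* h . (v (x) w) = h_1 v (x) h_2 w *)
Definition diag_lact (h : H) : tensor V W -> tensor V W :=
  tens2 (@lact V) (@lact W) (hdelta H h).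
(* (v (x) w) . h = v h_1 (x) w h_2 *)
Definition diag_ract (x : tensor V W) (h : H) : tensor V W :=
  tens2 (@ract V) (@ract W) x (hdelta H h).

Let lb := tens2_bilin (lact_bilin V) (lact_bilin W).
Let rb := tens2_bilin (ract_bilin V) (ract_bilin W).
Let lE := tens2E (lact_bilin V) (lact_bilin W).
Let rE := tens2E (ract_bilin V) (ract_bilin W).

Lemma diag_lact_bilin : bilin diag_lact.
Proof.
split=> [x a g h|h a x y]; rewrite /diag_lact ?linearP; first exact: lb.1.
exact: lb.2.
Qed.
Lemma diag_ract_bilin : bilin diag_ract.
Proof.
split=> [h a x y|x a g h]; rewrite /diag_ract ?linearP; first exact: rb.1.
exact: rb.2.
Qed.

Lemma diag_lact1 x : diag_lact 1 x = x.
Proof.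
rewrite /diag_lact hdelta1; elim/tens_ind: x => [v w|x y hx hy].
  by rewrite lE !lact1.
by rewrite (bilinDr lb) hx hy.
Qed.
Lemma diag_ract1 x : diag_ract x 1 = x.
Proof.
rewrite /diag_ract hdelta1; elim/tens_ind: x => [v w|x y hx hy].
  by rewrite rE !ract1.
by rewrite (bilinDl rb) hx hy.
Qed.

Let mb := tens2_bilin hmul_bilin hmul_bilin.
Let mE := tens2E hmul_bilin hmul_bilin.

Lemma diag_lactM g h x : diag_lact (g * h) x = diag_lact g (diag_lact h x).
Proof.
rewrite /diag_lact hdeltaM.
elim/tens_ind: (hdelta H g) => [a b|d d' hd hd']; last first.
  by rewrite (bilinDl mb) !(bilinDl lb) hd hd'.
elim/tens_ind: (hdelta H h) => [a' b'|d d' hd hd']; last first.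
  by rewrite (bilinDr mb) !(bilinDl lb) (bilinDr lb) hd hd'.
elim/tens_ind: x => [v w|x y hx hy]; first by rewrite mE !lE !lactM.
by rewrite !(bilinDr lb) hx hy.
Qed.
Lemma diag_ractM x g h : diag_ract x (g * h) = diag_ract (diag_ract x g) h.
Proof.
rewrite /diag_ract hdeltaM.
elim/tens_ind: (hdelta H g) => [a b|d d' hd hd']; last first.
  by rewrite (bilinDl mb) !(bilinDr rb) (bilinDl rb) hd hd'.
elim/tens_ind: (hdelta H h) => [a' b'|d d' hd hd']; last first.
  by rewrite (bilinDr mb) !(bilinDr rb) hd hd'.
elim/tens_ind: x => [v w|x y hx hy]; first by rewrite mE !rE !ractM.
by rewrite !(bilinDl rb) hx hy.
Qed.
Lemma diag_lractC g x h : diag_ract (diag_lact g x) h = diag_lact g (diag_ract x h).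
Proof.
rewrite /diag_lact /diag_ract.
elim/tens_ind: (hdelta H g) => [a b|d d' hd hd']; last first.
  by rewrite !(bilinDl lb) (bilinDl rb) hd hd'.
elim/tens_ind: (hdelta H h) => [a' b'|d d' hd hd']; last first.
  by rewrite !(bilinDr rb) (bilinDr lb) hd hd'.
elim/tens_ind: x => [v w|x y hx hy]; first by rewrite !(lE, rE) !lractC.
by rewrite (bilinDr lb) !(bilinDl rb) (bilinDr lb) hx hy.
Qed.

Definition hbimod_tensor : hbimod :=
  Hbimod diag_lact_bilin diag_ract_bilin diag_lact1 diag_lactM diag_ract1 diag_ractM
    diag_lractC.
End DiagonalAction.
End Hopf.

Section Tens2Theory.
Variable K : fieldType.

Lemma bilin_comp (U V U' V' Z Z' : lmodType K) (f : U' -> V' -> Z)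
    (a : {linear U -> U'}) (b : {linear V -> V'}) (c : {linear Z -> Z'}) :
  bilin f -> bilin (fun u v => c (f (a u) (b v))).
Proof.
move=> hf; split=> [w x y z|v x y z] /=.
  by rewrite linearP hf.1 linearP.
by rewrite linearP hf.2 linearP.
Qed.

Lemma tens_bilin_ext (U V U' V' Z : lmodType K)
    (f g : tensor U V -> tensor U' V' -> Z) : bilin f -> bilin g ->
  (forall a b c d, f (tmk a b) (tmk c d) = g (tmk a b) (tmk c d)) ->
  forall x y, f x y = g x y.
Proof.
move=> hf hg h x y; elim/tens_ind: x => [a b|x x' hx hx']; last first.
  by rewrite (bilinDl hf) (bilinDl hg) hx hx'.
elim/tens_ind: y => [c d|y y' hy hy'] //.
by rewrite (bilinDr hf) (bilinDr hg) hy hy'.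
Qed.

Lemma tens2_assoc (U V U' V' U'' V'' Z Z' Z'' : lmodType K)
    (f : U -> V -> Z) (g : U' -> V' -> Z') (h : U'' -> V'' -> Z'')
    (hf : bilin f) (hg : bilin g) (hh : bilin h) x y :
  tassoc (tens2 (tens2 f g) h x y) = tens2 f (tens2 g h) (tassoc x) (tassoc y).
Proof.
have b1 := tens2_bilin (tens2_bilin hf hg) hh.
have b2 := tens2_bilin hf (tens2_bilin hg hh).
elim/tens3_ind: x => [a b c|x x' hx hx']; last first.
  by rewrite (bilinDl b1) !linearD /= (bilinDl b2) hx hx'.
elim/tens3_ind: y => [u v w|y y' hy hy']; last first.
  by rewrite (bilinDr b1) !linearD /= (bilinDr b2) hy hy'.
rewrite !tassocE !tens2E ?tassocE //; exact: tens2_bilin.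
Qed.

Lemma tens2_map (U V U' V' Z Z' U1 V1 U1' V1' Z1 Z1' : lmodType K)
    (f : U -> V -> Z) (g : U' -> V' -> Z') (f1 : U1 -> V1 -> Z1) (g1 : U1' -> V1' -> Z1')
    (a : {linear U -> U1}) (b : {linear V -> V1}) (c : {linear Z -> Z1})
    (a' : {linear U' -> U1'}) (b' : {linear V' -> V1'}) (c' : {linear Z' -> Z1'})
    (hf : bilin f) (hg : bilin g) (hf1 : bilin f1) (hg1 : bilin g1) :
  (forall u v, c (f u v) = f1 (a u) (b v)) ->
  (forall u v, c' (g u v) = g1 (a' u) (b' v)) ->
  forall x y, tmap c c' (tens2 f g x y) = tens2 f1 g1 (tmap a a' x) (tmap b b' y).
Proof.
move=> e e' x y; have b1 := tens2_bilin hf hg; have b2 := tens2_bilin hf1 hg1.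
elim/tens_ind: x => [u u'|x x' hx hx']; last first.
  by rewrite (bilinDl b1) !linearD /= (bilinDl b2) hx hx'.
elim/tens_ind: y => [v v'|y y' hy hy']; last first.
  by rewrite (bilinDr b1) !linearD /= (bilinDr b2) hy hy'.
by rewrite !tmapE !tens2E // tmapE e e'.
Qed.

Lemma tmap_id (V W : lmodType K) x :
  tmap (idfun : {linear V -> V}) (idfun : {linear W -> W}) x = x.
Proof. exact: vect_ten1. Qed.

End Tens2Theory.

Section HopfBimod.
Variables (K : fieldType) (H : hopf_algebra K).

Lemma hbimod_ten_subproof (V V' W W' : hbimod H) (f : hbimod_hom V V') (g : hbimod_hom W W') :
  @is_hbimod_hom K H (hbimod_tensor V W) (hbimod_tensor V' W') (tmap (sval f) (sval g)).
Proof.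
case: f g => [f [fl fr]] [g [gl gr]]; split=> [h x|x h] /=.
  rewrite /diag_lact -[in RHS](tmap_id (hdelta H h)).
  by apply: (tens2_map (a := idfun) (b := f) (c := f) (a' := idfun) (b' := g) (c' := g)); rewrite //; apply: lact_bilin.
rewrite /diag_ract -[in RHS](tmap_id (hdelta H h)).
by apply: (tens2_map (a := f) (b := idfun) (c := f) (a' := g) (b' := idfun) (c' := g)); rewrite //; apply: ract_bilin.
Qed.

Definition hbimod_tensor_hom (V V' W W' : hbimod H) (f : hbimod_hom V V')
    (g : hbimod_hom W W') : hbimod_hom (hbimod_tensor V W) (hbimod_tensor V' W') :=
  exist _ (tmap (sval f) (sval g) : {linear tensor V W -> tensor V' W'})
    (hbimod_ten_subproof f g).

Lemma counit_lact_bilin (V : lmodType K) : bilin (fun (h : H) (v : V) => (heps H h : K) *: v).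
Proof. exact: (bilin_comp (heps H) idfun idfun (scale_bilin V)). Qed.
Lemma counit_ract_bilin (V : lmodType K) : bilin (fun (v : V) (h : H) => (heps H h : K) *: v).
Proof. exact: (bilin_comp idfun (heps H) idfun (scaler_bilin V)). Qed.

Definition hbimod_unit : hbimod H.
Proof.
refine (@Hbimod K H (K^o : lmodType K) (fun h k => (heps H h : K) *: k)
  (fun k h => (heps H h : K) *: k) (counit_lact_bilin _) (counit_ract_bilin _) _ _ _ _ _).
- by move=> v; rewrite heps1 scale1r.
- by move=> g h v; rewrite hepsM scalerA.
- by move=> v; rewrite heps1 scale1r.
- by move=> v g h; rewrite hepsM scalerA mulrC.
- by move=> g v h; rewrite !scalerA mulrC.
Defined.

Lemma inv_hbimod_hom (V W : hbimod H) (f : {linear V -> W}) (g : {linear W -> V}) :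
  cancel f g -> cancel g f -> is_hbimod_hom f -> is_hbimod_hom g.
Proof.
move=> fK gK [fl fr]; split=> [h w|w h].
  by rewrite -{1}[w]gK -fl fK.
by rewrite -{1}[w]gK -fr fK.
Qed.

Lemma diag_lact_assoc (U V W : hbimod H) h (x : tensor (tensor U V) W) :
  tassoc (@diag_lact K H (hbimod_tensor U V) W h x) =
  @diag_lact K H U (hbimod_tensor V W) h (tassoc x).
Proof.
have bU := lact_bilin U; have bV := lact_bilin V; have bW := lact_bilin W.
transitivity (tassoc (tens2 (tens2 (@lact _ _ U) (@lact _ _ V)) (@lact _ _ W)
    (tmap (hdelta H) (idfun : {linear H -> H}) (hdelta H h)) x)).
  congr tassoc; rewrite -[LHS]tmap_id -[x in RHS]tmap_id.
  apply: tens2_map => //; [exact: diag_lact_bilin|exact: tens2_bilin].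
rewrite tens2_assoc // hdeltaA -[RHS]tmap_id -[tassoc x in LHS]tmap_id; apply/esym.
apply: tens2_map => //; [exact: diag_lact_bilin|exact: tens2_bilin].
Qed.

Lemma diag_ract_assoc (U V W : hbimod H) h (x : tensor (tensor U V) W) :
  tassoc (@diag_ract K H (hbimod_tensor U V) W x h) =
  @diag_ract K H U (hbimod_tensor V W) (tassoc x) h.
Proof.
have bU := ract_bilin U; have bV := ract_bilin V; have bW := ract_bilin W.
transitivity (tassoc (tens2 (tens2 (@ract _ _ U) (@ract _ _ V)) (@ract _ _ W)
    x (tmap (hdelta H) (idfun : {linear H -> H}) (hdelta H h)))).
  congr tassoc; rewrite -[LHS]tmap_id -[x in RHS]tmap_id.
  apply: tens2_map => //; [exact: diag_ract_bilin|exact: tens2_bilin].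
rewrite tens2_assoc // hdeltaA -[RHS]tmap_id -[tassoc x in LHS]tmap_id; apply/esym.
apply: tens2_map => //; [exact: diag_ract_bilin|exact: tens2_bilin].
Qed.

Lemma tassoc_hbimod (U V W : hbimod H) :
  @is_hbimod_hom K H (hbimod_tensor (hbimod_tensor U V) W)
    (hbimod_tensor U (hbimod_tensor V W)) (@tassoc K U V W).
Proof. by split=> [h x|x h]; [apply: diag_lact_assoc|apply: diag_ract_assoc]. Qed.

Lemma tlunit_hbimod (V : hbimod H) :
  @is_hbimod_hom K H (hbimod_tensor hbimod_unit V) V (@tlunit K V).
Proof.
have bl := tens2_bilin (lact_bilin hbimod_unit) (lact_bilin V).
have br := tens2_bilin (ract_bilin hbimod_unit) (ract_bilin V).
split=> [h x|x h] /=; elim/tens_ind: x => [k v|x y hx hy].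
- rewrite tlunitE -{2}[h](heps1l) /= /diag_lact.
  elim/tens_ind: (hdelta H h) => [a b|d d' hd hd'].
    rewrite tens2E; [|exact: lact_bilin|exact: lact_bilin].
    rewrite tlunitE tlift_tmk; last exact: counit_lact_bilin.
    by rewrite !(bilin_Zl (lact_bilin V)) (bilin_Zr (lact_bilin V)) /= scalerA.
  rewrite (bilinDl bl) linearD /= hd hd' (tliftD (counit_lact_bilin _)).
  by rewrite (bilinDl (lact_bilin V)).
- by rewrite (bilinDr (diag_lact_bilin _ _)) !linearD /= hx hy (bilinDr (lact_bilin V)).
- rewrite tlunitE -{2}[h](heps1l) /= /diag_ract.
  elim/tens_ind: (hdelta H h) => [a b|d d' hd hd'].
    rewrite tens2E; [|exact: ract_bilin|exact: ract_bilin].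
    rewrite tlunitE tlift_tmk; last exact: counit_lact_bilin.
    by rewrite !(bilin_Zr (ract_bilin V)) (bilin_Zl (ract_bilin V)) /= scalerA.
  rewrite (bilinDr br) linearD /= hd hd' (tliftD (counit_lact_bilin _)).
  by rewrite (bilinDr (ract_bilin V)).
- by rewrite (bilinDl (diag_ract_bilin _ _)) !linearD /= hx hy (bilinDl (ract_bilin V)).
Qed.

Lemma trunit_hbimod (V : hbimod H) :
  @is_hbimod_hom K H (hbimod_tensor V hbimod_unit) V (@trunit K V).
Proof.
have bl := tens2_bilin (lact_bilin V) (lact_bilin hbimod_unit).
have br := tens2_bilin (ract_bilin V) (ract_bilin hbimod_unit).
split=> [h x|x h] /=; elim/tens_ind: x => [v k|x y hx hy].
- rewrite trunitE -{2}[h](heps1r) /= /diag_lact.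
  elim/tens_ind: (hdelta H h) => [a b|d d' hd hd'].
    rewrite tens2E; [|exact: lact_bilin|exact: lact_bilin].
    rewrite trunitE tlift_tmk; last exact: counit_ract_bilin.
    by rewrite !(bilin_Zl (lact_bilin V)) (bilin_Zr (lact_bilin V)) /= scalerA.
  rewrite (bilinDl bl) linearD /= hd hd' (tliftD (counit_ract_bilin _)).
  by rewrite (bilinDl (lact_bilin V)).
- by rewrite (bilinDr (diag_lact_bilin _ _)) !linearD /= hx hy (bilinDr (lact_bilin V)).
- rewrite trunitE -{2}[h](heps1r) /= /diag_ract.
  elim/tens_ind: (hdelta H h) => [a b|d d' hd hd'].
    rewrite tens2E; [|exact: ract_bilin|exact: ract_bilin].
    rewrite trunitE tlift_tmk; last exact: counit_ract_bilin.
    by rewrite !(bilin_Zr (ract_bilin V)) (bilin_Zl (ract_bilin V)) /= scalerA.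
  rewrite (bilinDr br) linearD /= hd hd' (tliftD (counit_ract_bilin _)).
  by rewrite (bilinDr (ract_bilin V)).
- by rewrite (bilinDl (diag_ract_bilin _ _)) !linearD /= hx hy (bilinDl (ract_bilin V)).
Qed.

Lemma tassocV_hbimod (U V W : hbimod H) :
  @is_hbimod_hom K H (hbimod_tensor U (hbimod_tensor V W))
    (hbimod_tensor (hbimod_tensor U V) W) (@tassocV K U V W).
Proof.
apply: (@inv_hbimod_hom (hbimod_tensor (hbimod_tensor U V) W)
  (hbimod_tensor U (hbimod_tensor V W)) (@tassoc K U V W)); last exact: tassoc_hbimod.
- exact: vect_assocK.
- exact: vect_assocVK.
Qed.

Lemma tlunitV_hbimod (V : hbimod H) :
  @is_hbimod_hom K H V (hbimod_tensor hbimod_unit V) (@tlunitV K V).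
Proof.
apply: (@inv_hbimod_hom (hbimod_tensor hbimod_unit V) V (@tlunit K V));
  last exact: tlunit_hbimod.
- exact: vect_lunitK.
- exact: vect_lunitVK.
Qed.

Lemma trunitV_hbimod (V : hbimod H) :
  @is_hbimod_hom K H V (hbimod_tensor V hbimod_unit) (@trunitV K V).
Proof.
apply: (@inv_hbimod_hom (hbimod_tensor V hbimod_unit) V (@trunit K V));
  last exact: trunit_hbimod.
- exact: vect_runitK.
- exact: vect_runitVK.
Qed.

Definition hbimod_monoidal : monoidal.
Proof.
refine (@Monoidal (hbimod_cat H) (@hbimod_tensor K H) hbimod_tensor_hom hbimod_unit
  (fun U V W => exist _ _ (tassoc_hbimod U V W))
  (fun U V W => exist _ _ (tassocV_hbimod U V W))
  (fun V => exist _ _ (tlunit_hbimod V))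
  (fun V => exist _ _ (tlunitV_hbimod V))
  (fun V => exist _ _ (trunit_hbimod V))
  (fun V => exist _ _ (trunitV_hbimod V))
  _ _ _ _ _ _ _ _ _ _ _ _ _).
- by move=> V W; apply: eq_exist; apply: lin_ext; apply: vect_ten1.
- by move=> X X' X'' Y Y' Y'' f' f g' g; apply: eq_exist; apply: lin_ext; apply: vect_tenM.
- by move=> U V W; apply: eq_exist; apply: lin_ext; apply: vect_assocK.
- by move=> U V W; apply: eq_exist; apply: lin_ext; apply: vect_assocVK.
- by move=> V; apply: eq_exist; apply: lin_ext; apply: vect_lunitK.
- by move=> V; apply: eq_exist; apply: lin_ext; apply: vect_lunitVK.
- by move=> V; apply: eq_exist; apply: lin_ext; apply: vect_runitK.
- by move=> V; apply: eq_exist; apply: lin_ext; apply: vect_runitVK.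
- move=> U U' V V' W W' f g h; apply: eq_exist; apply: lin_ext => x.
  exact: (vect_assoc_nat (sval f) (sval g) (sval h)).
- by move=> V V' [f hf]; apply: eq_exist; apply: lin_ext => x; apply: (vect_lunit_nat f).
- by move=> V V' [f hf]; apply: eq_exist; apply: lin_ext => x; apply: (vect_runit_nat f).
- move=> U V W X; apply: eq_exist; apply: lin_ext => x; exact: vect_pentagon.
- by move=> V W; apply: eq_exist; apply: lin_ext; apply: vect_triangle.
Defined.

End HopfBimod.

Section HopfCoalgebra.
Variables (K : fieldType) (H : hopf_algebra K).

Definition hopf_bimod : hbimod H.
Proof.
refine (@Hbimod K H H (fun g h => g * h) (fun g h => g * h)
  (hmul_bilin H) (hmul_bilin H) _ _ _ _ _).
- exact: mul1r.
- by move=> g h v; rewrite mulrA.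
- exact: mulr1.
- by move=> v g h; rewrite mulrA.
- by move=> g v h; rewrite mulrA.
Defined.

Lemma hdelta_hbimod : @is_hbimod_hom K H hopf_bimod (hbimod_tensor hopf_bimod hopf_bimod) (hdelta H).
Proof. by split=> [h v|v h] /=; rewrite hdeltaM. Qed.

Lemma heps_hbimod : @is_hbimod_hom K H hopf_bimod (hbimod_unit H) (heps H).
Proof. by split=> [h v|v h] /=; rewrite hepsM // mulrC. Qed.

Lemma tlunit_heps (h : H) :
  tlunit (tmap (heps H) (idfun : {linear H -> H}) (hdelta H h)) = h.
Proof.
rewrite -[RHS](heps1l h); elim/tens_ind: (hdelta H h) => [a b|x y hx hy].
  by rewrite tmapE tlunitE (tlift_tmk _ _ (counit_lact_bilin _ _)).
by rewrite !linearD /= hx hy (tliftD (counit_lact_bilin _ _)).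
Qed.

Lemma trunit_heps (h : H) :
  trunit (tmap (idfun : {linear H -> H}) (heps H) (hdelta H h)) = h.
Proof.
rewrite -[RHS](heps1r h); elim/tens_ind: (hdelta H h) => [a b|x y hx hy].
  by rewrite tmapE trunitE (tlift_tmk _ _ (counit_ract_bilin _ _)).
by rewrite !linearD /= hx hy (tliftD (counit_ract_bilin _ _)).
Qed.

(* H as a coalgebra in the monoidal category of H-bimodules *)
Definition hopf_bimod_coalg : coalgebra_in (hbimod_monoidal H).
Proof.
refine (@CoalgebraIn (hbimod_monoidal H) hopf_bimod
  (exist _ _ hdelta_hbimod) (exist _ _ heps_hbimod) _ _ _).
- by apply: eq_exist; apply: lin_ext => h; apply: hdeltaA.
- by apply: eq_exist; apply: lin_ext => h; apply: tlunit_heps.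
- by apply: eq_exist; apply: lin_ext => h; apply: trunit_heps.
Defined.

Definition forget_coalg (C : coalgebra_in (hbimod_monoidal H)) : coalgebra_in (vect K) :=
  @CoalgebraIn (vect K) (hbimod_mod (coalgob C)) (sval (cdelta C)) (sval (ceps C))
    (congr1 sval (cdeltaA C)) (congr1 sval (cdelta1l C)) (congr1 sval (cdelta1r C)).

Section ForgetBicomodule.
Variable C : coalgebra_in (hbimod_monoidal H).

Definition forget_bicomod_ob (X : bicomodule C) : bicomodule (forget_coalg C) :=
  @Bicomodule (vect K) (forget_coalg C) (hbimod_mod (bicomob X))
    (sval (bcl X)) (sval (bcr X))
    (congr1 sval (bclA X)) (congr1 sval (bcl1 X))
    (congr1 sval (bcrA X)) (congr1 sval (bcr1 X)) (congr1 sval (bclr X)).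

Definition forget_bicomod_hom (X Y : bicomodule C) (f : bicomod_hom X Y) :
    bicomod_hom (forget_bicomod_ob X) (forget_bicomod_ob Y) :=
  exist (@is_bicomod_hom (vect K) (forget_coalg C) (forget_bicomod_ob X) (forget_bicomod_ob Y))
    (sval (sval f))
    (conj (congr1 sval (svalP f).1) (congr1 sval (svalP f).2)).

Definition forget_bicomod : functor (bicomod_cat C) (bicomod_cat (forget_coalg C)).
Proof.
refine (@Functor (bicomod_cat C) (bicomod_cat (forget_coalg C))
  forget_bicomod_ob forget_bicomod_hom _ _).
- by move=> X; apply: eq_exist.
- by move=> X Y Z g f; apply: eq_exist.
Defined.
End ForgetBicomodule.

(* The coalgebra H in K-spaces; its structure maps are convertible to hdelta and heps. *)
Definition hopf_coalg : coalgebra_in (vect K) := forget_coalg hopf_bimod_coalg.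

End HopfCoalgebra.

Lemma inv_bicomod_hom (M : monoidal) (C : coalgebra_in M) (X Y : bicomodule C)
    (f : Hom (X : M) Y) (g : Hom (Y : M) X) :
  g \oc f = idc _ -> f \oc g = idc _ -> is_bicomod_hom f -> is_bicomod_hom g.
Proof.
move=> gf fg [fl fr]; split.
  rewrite -[LHS]comp1c -mten1 -gf mtenl compcA.
  by rewrite -[(_ \om f) \oc _]compcA -fl compcA fg compc1.
rewrite -[LHS]comp1c -mten1 -gf mtenr compcA.
by rewrite -[(f \om _) \oc _]compcA -fr compcA fg compc1.
Qed.

Section Codiagonal.
Variables (K : fieldType) (H : hopf_algebra K).
Implicit Types V W U : lmodType K.

Let hm := hmul_bilin H.
Let tm := tmk_bilin.

Section Pair.
Variables (V W : lmodType K).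
Variables (lV : {linear V -> tensor H V}) (lW : {linear W -> tensor H W}).
Variables (rV : {linear V -> tensor V H}) (rW : {linear W -> tensor W H}).

Lemma codiag_l_bilin : bilin (fun v w => tens2 *%R (@tmk K V W) (lV v) (lW w)).
Proof. exact: (bilin_comp lV lW idfun (tens2_bilin hm (tm V W))). Qed.
Lemma codiag_r_bilin : bilin (fun v w => tens2 (@tmk K V W) *%R (rV v) (rW w)).
Proof. exact: (bilin_comp rV rW idfun (tens2_bilin (tm V W) hm)). Qed.

(* v (x) w |-> v_{-1} w_{-1} (x) (v_0 (x) w_0) *)
Definition codiag_l : tensor V W -> tensor H (tensor V W) :=
  tlift (fun v w => tens2 *%R (@tmk K V W) (lV v) (lW w)).
(* v (x) w |-> (v_0 (x) w_0) (x) v_1 w_1 *)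
Definition codiag_r : tensor V W -> tensor (tensor V W) H :=
  tlift (fun v w => tens2 (@tmk K V W) *%R (rV v) (rW w)).
HB.instance Definition _ := GRing.isLinear.Build K _ _ *:%R codiag_l (tlift_linear codiag_l_bilin).
HB.instance Definition _ := GRing.isLinear.Build K _ _ *:%R codiag_r (tlift_linear codiag_r_bilin).

Lemma codiag_lE v w : codiag_l (tmk v w) = tens2 *%R (@tmk K V W) (lV v) (lW w).
Proof. exact: (tlift_tmk v w codiag_l_bilin). Qed.
Lemma codiag_rE v w : codiag_r (tmk v w) = tens2 (@tmk K V W) *%R (rV v) (rW w).
Proof. exact: (tlift_tmk v w codiag_r_bilin). Qed.
End Pair.
Arguments codiag_l : simpl never.
Arguments codiag_r : simpl never.

Section Laws.
Variables (V W : lmodType K).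
Variables (lV : {linear V -> tensor H V}) (lW : {linear W -> tensor H W}).
Variables (rV : {linear V -> tensor V H}) (rW : {linear W -> tensor W H}).
Let idH : {linear H -> H} := idfun.
Let idV : {linear V -> V} := idfun.
Let idW : {linear W -> W} := idfun.
Let idVW : {linear tensor V W -> tensor V W} := idfun.

Hypothesis lVA : forall v, tassoc (tmap (hdelta H) idV (lV v)) = tmap idH lV (lV v).
Hypothesis lWA : forall v, tassoc (tmap (hdelta H) idW (lW v)) = tmap idH lW (lW v).
Hypothesis lV1 : forall v, tlunit (tmap (heps H) idV (lV v)) = v.
Hypothesis lW1 : forall v, tlunit (tmap (heps H) idW (lW v)) = v.
Hypothesis rVA : forall v, tassoc (tmap rV idH (rV v)) = tmap idV (hdelta H) (rV v).
Hypothesis rWA : forall v, tassoc (tmap rW idH (rW v)) = tmap idW (hdelta H) (rW v).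
Hypothesis rV1 : forall v, trunit (tmap idV (heps H) (rV v)) = v.
Hypothesis rW1 : forall v, trunit (tmap idW (heps H) (rW v)) = v.
Hypothesis lrV : forall v, tassoc (tmap lV idH (rV v)) = tmap idH rV (lV v).
Hypothesis lrW : forall v, tassoc (tmap lW idH (rW v)) = tmap idH rW (lW v).

Let hh := tens2_bilin hm hm.
Let ht := tens2_bilin hm (tm V W).
Let th := tens2_bilin (tm V W) hm.

Lemma codiag_lA x :
  tassoc (tmap (hdelta H) idVW (codiag_l lV lW x)) =
  tmap idH (codiag_l lV lW) (codiag_l lV lW x).
Proof.
elim/tens_ind: x => [v w|x y hx hy]; last by rewrite !linearD /= hx hy.
rewrite codiag_lE.
rewrite (tens2_map (a := hdelta H) (b := hdelta H) (a' := idV) (b' := idW)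
  hm (tm V W) hh (tm V W)) //; last exact: hdeltaM.
rewrite tens2_assoc // lVA lWA.
rewrite (tens2_map (a := idH) (b := idH) (a' := lV) (b' := lW) hm (tm V W) hm ht) //.
exact: codiag_lE.
Qed.

Lemma codiag_rA x :
  tassoc (tmap (codiag_r rV rW) idH (codiag_r rV rW x)) =
  tmap idVW (hdelta H) (codiag_r rV rW x).
Proof.
elim/tens_ind: x => [v w|x y hx hy]; last by rewrite !linearD /= hx hy.
rewrite codiag_rE; apply/esym.
rewrite (tens2_map (a' := hdelta H) (b' := hdelta H) (a := idV) (b := idW)
  (tm V W) hm (tm V W) hh) //; last exact: hdeltaM.
rewrite -rVA -rWA -tens2_assoc //.
rewrite (tens2_map (a' := idH) (b' := idH) (a := rV) (b := rW) (tm V W) hm th hm) //.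
exact: codiag_rE.
Qed.

Lemma codiag_lr x :
  tassoc (tmap (codiag_l lV lW) idH (codiag_r rV rW x)) =
  tmap idH (codiag_r rV rW) (codiag_l lV lW x).
Proof.
elim/tens_ind: x => [v w|x y hx hy]; last by rewrite !linearD /= hx hy.
rewrite codiag_rE codiag_lE.
rewrite (tens2_map (a' := idH) (b' := idH) (a := lV) (b := lW) (tm V W) hm ht hm) //;
  last exact: codiag_lE.
rewrite tens2_assoc // lrV lrW.
rewrite (tens2_map (a := idH) (b := idH) (a' := rV) (b' := rW) hm (tm V W) hm th) //.
exact: codiag_rE.
Qed.

Lemma codiag_l1 x : tlunit (tmap (heps H) idVW (codiag_l lV lW x)) = x.
Proof.
elim/tens_ind: x => [v w|x y hx hy]; last by rewrite !linearD /= hx hy.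
rewrite codiag_lE -[in RHS](lV1 v) -[in RHS](lW1 w).
apply: (tens_bilin_ext (f := fun X Y => tlunit (tmap (heps H) idVW (tens2 *%R (@tmk K V W) X Y)))
   (g := fun X Y => tmk (tlunit (tmap (heps H) idV X)) (tlunit (tmap (heps H) idW Y)))).
- exact: (bilin_comp idfun idfun (@tlunit K _ \o tmap (heps H) idVW) ht).
- exact: (bilin_comp (@tlunit K _ \o tmap (heps H) idV) (@tlunit K _ \o tmap (heps H) idW) idfun (tm V W)).
- move=> a b c d; rewrite tens2E // !tmapE !tlunitE /= hepsM.
  by rewrite tmkZl tmkZr scalerA.
Qed.

Lemma codiag_r1 x : trunit (tmap idVW (heps H) (codiag_r rV rW x)) = x.
Proof.
elim/tens_ind: x => [v w|x y hx hy]; last by rewrite !linearD /= hx hy.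
rewrite codiag_rE -[in RHS](rV1 v) -[in RHS](rW1 w).
apply: (tens_bilin_ext (f := fun X Y => trunit (tmap idVW (heps H) (tens2 (@tmk K V W) *%R X Y)))
   (g := fun X Y => tmk (trunit (tmap idV (heps H) X)) (trunit (tmap idW (heps H) Y)))).
- exact: (bilin_comp idfun idfun (@trunit K _ \o tmap idVW (heps H)) th).
- exact: (bilin_comp (@trunit K _ \o tmap idV (heps H)) (@trunit K _ \o tmap idW (heps H)) idfun (tm V W)).
- move=> a b c d; rewrite tens2E // !tmapE !trunitE /= hepsM.
  by rewrite tmkZl tmkZr scalerA.
Qed.
End Laws.

Section Maps.
Variables (V V' W W' : lmodType K) (f : {linear V -> V'}) (g : {linear W -> W'}).

Lemma codiag_l_nat (lV : {linear V -> tensor H V}) (lW : {linear W -> tensor H W})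
    (lV' : {linear V' -> tensor H V'}) (lW' : {linear W' -> tensor H W'}) :
  (forall v, lV' (f v) = tmap (idfun : {linear H -> H}) f (lV v)) ->
  (forall w, lW' (g w) = tmap (idfun : {linear H -> H}) g (lW w)) ->
  forall x, codiag_l lV' lW' (tmap f g x) =
            tmap (idfun : {linear H -> H}) (tmap f g) (codiag_l lV lW x).
Proof.
move=> hf hg x; elim/tens_ind: x => [v w|x y hx hy]; last by rewrite !linearD /= hx hy.
rewrite tmapE !codiag_lE hf hg; apply/esym.
by apply: (tens2_map hm (tm V W) hm (tm V' W')) => // a b; apply: tmapE.
Qed.

Lemma codiag_r_nat (lV : {linear V -> tensor V H}) (lW : {linear W -> tensor W H})
    (lV' : {linear V' -> tensor V' H}) (lW' : {linear W' -> tensor W' H}) :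
  (forall v, lV' (f v) = tmap f (idfun : {linear H -> H}) (lV v)) ->
  (forall w, lW' (g w) = tmap g (idfun : {linear H -> H}) (lW w)) ->
  forall x, codiag_r lV' lW' (tmap f g x) =
            tmap (tmap f g) (idfun : {linear H -> H}) (codiag_r lV lW x).
Proof.
move=> hf hg x; elim/tens_ind: x => [v w|x y hx hy]; last by rewrite !linearD /= hx hy.
rewrite tmapE !codiag_rE hf hg; apply/esym.
by apply: (tens2_map (tm V W) hm (tm V' W') hm) => // a b; apply: tmapE.
Qed.
End Maps.

Section Assoc.
Variables (U V W : lmodType K).
Variables (lU : {linear U -> tensor H U}) (lV : {linear V -> tensor H V})
  (lW : {linear W -> tensor H W}).
Variables (rU : {linear U -> tensor U H}) (rV : {linear V -> tensor V H})
  (rW : {linear W -> tensor W H}).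
Let idH : {linear H -> H} := idfun.

Lemma codiag_l_assoc x :
  codiag_l lU (codiag_l lV lW) (tassoc x) =
  tmap idH (@tassoc K U V W) (codiag_l (codiag_l lU lV) lW x).
Proof.
elim/tens3_ind: x => [u v w|x y hx hy]; last by rewrite !linearD /= hx hy.
have b1 := tens2_bilin hm (tm U V); have b2 := tens2_bilin hm (tm V W).
have b3 := tens2_bilin hm (tm U (tensor V W)); have b4 := tens2_bilin hm (tm (tensor U V) W).
rewrite tassocE !codiag_lE /= !codiag_lE.
move: (lU u) (lV v) (lW w) => x y z.
elim/tens_ind: x => [a a'|x x' hx hx']; last first.
  by rewrite (bilinDl b1) (bilinDl b3) (bilinDl b4) linearD /= hx hx'.
elim/tens_ind: y => [b b'|y y' hy hy']; last first.
  by rewrite (bilinDl b2) (bilinDr b1) (bilinDr b3) (bilinDl b4) linearD /= hy hy'.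
elim/tens_ind: z => [c c'|z z' hz hz']; last first.
  by rewrite (bilinDr b2) (bilinDr b3) (bilinDr b4) linearD /= hz hz'.
by rewrite !tens2E // tmapE /= tassocE mulrA.
Qed.

Lemma codiag_r_assoc x :
  codiag_r rU (codiag_r rV rW) (tassoc x) =
  tmap (@tassoc K U V W) idH (codiag_r (codiag_r rU rV) rW x).
Proof.
elim/tens3_ind: x => [u v w|x y hx hy]; last by rewrite !linearD /= hx hy.
have b1 := tens2_bilin (tm U V) hm; have b2 := tens2_bilin (tm V W) hm.
have b3 := tens2_bilin (tm U (tensor V W)) hm; have b4 := tens2_bilin (tm (tensor U V) W) hm.
rewrite tassocE !codiag_rE /= !codiag_rE.
move: (rU u) (rV v) (rW w) => x y z.
elim/tens_ind: x => [a a'|x x' hx hx']; last first.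
  by rewrite (bilinDl b1) (bilinDl b3) (bilinDl b4) linearD /= hx hx'.
elim/tens_ind: y => [b b'|y y' hy hy']; last first.
  by rewrite (bilinDl b2) (bilinDr b1) (bilinDr b3) (bilinDl b4) linearD /= hy hy'.
elim/tens_ind: z => [c c'|z z' hz hz']; last first.
  by rewrite (bilinDr b2) (bilinDr b3) (bilinDr b4) linearD /= hz hz'.
by rewrite !tens2E // tmapE /= tassocE mulrA.
Qed.
End Assoc.

Section Unit.
Definition triv_l (k : K^o) : tensor H K^o := tmk (1 : H) k.
Definition triv_r (k : K^o) : tensor K^o H := tmk k (1 : H).
HB.instance Definition _ := GRing.isLinear.Build K _ _ *:%R triv_l ((tmk_bilin H K^o).2 1).
HB.instance Definition _ := GRing.isLinear.Build K _ _ *:%R triv_r ((tmk_bilin K^o H).1 1).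

Variables (V : lmodType K) (lV : {linear V -> tensor H V}) (rV : {linear V -> tensor V H}).
Let idH : {linear H -> H} := idfun.

Lemma codiag_l_lunit x : lV (tlunit x) = tmap idH (@tlunit K V) (codiag_l triv_l lV x).
Proof.
elim/tens_ind: x => [k v|x y hx hy]; last by rewrite !linearD /= hx hy.
have b := tens2_bilin hm (tm K^o V).
rewrite tlunitE linearZ codiag_lE /= /triv_l.
elim/tens_ind: (lV v) => [a u|x y hx hy]; last by rewrite scalerDr (bilinDr b) linearD /= hx hy.
by rewrite tens2E // tmapE /= tlunitE mul1r tmkZr.
Qed.
Lemma codiag_r_lunit x : rV (tlunit x) = tmap (@tlunit K V) idH (codiag_r triv_r rV x).
Proof.
elim/tens_ind: x => [k v|x y hx hy]; last by rewrite !linearD /= hx hy.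
have b := tens2_bilin (tm K^o V) hm.
rewrite tlunitE linearZ codiag_rE /= /triv_r.
elim/tens_ind: (rV v) => [a u|x y hx hy]; last by rewrite scalerDr (bilinDr b) linearD /= hx hy.
by rewrite tens2E // tmapE /= tlunitE mul1r tmkZl.
Qed.
Lemma codiag_l_runit x : lV (trunit x) = tmap idH (@trunit K V) (codiag_l lV triv_l x).
Proof.
elim/tens_ind: x => [v k|x y hx hy]; last by rewrite !linearD /= hx hy.
have b := tens2_bilin hm (tm V K^o).
rewrite trunitE linearZ codiag_lE /= /triv_l.
elim/tens_ind: (lV v) => [a u|x y hx hy]; last by rewrite scalerDr (bilinDl b) linearD /= hx hy.
by rewrite tens2E // tmapE /= trunitE mulr1 tmkZr.
Qed.
Lemma codiag_r_runit x : rV (trunit x) = tmap (@trunit K V) idH (codiag_r rV triv_r x).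
Proof.
elim/tens_ind: x => [v k|x y hx hy]; last by rewrite !linearD /= hx hy.
have b := tens2_bilin (tm V K^o) hm.
rewrite trunitE linearZ codiag_rE /= /triv_r.
elim/tens_ind: (rV v) => [a u|x y hx hy]; last by rewrite scalerDr (bilinDl b) linearD /= hx hy.
by rewrite tens2E // tmapE /= trunitE mulr1 tmkZl.
Qed.
End Unit.
End Codiagonal.

Section BicomodMonoidal.
Variables (K : fieldType) (H : hopf_algebra K).

Notation bcm := (@bicomodule (vect K) (hopf_coalg H)).

Lemma lin_congr (V W : lmodType K) (f g : {linear V -> W}) : f = g -> f =1 g.
Proof. by move=> ->. Qed.

Definition bicomod_left (X : bcm) :
  {linear (bicomob X : lmodType K) -> tensor H (bicomob X : lmodType K)} := bcl X.
Definition bicomod_right (X : bcm) :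
  {linear (bicomob X : lmodType K) -> tensor (bicomob X : lmodType K) H} := bcr X.

Definition bicomod_tensor (X Y : bcm) : bcm.
Proof.
refine (@Bicomodule (vect K) (hopf_coalg H)
  (tensor (bicomob X : lmodType K) (bicomob Y : lmodType K) : lmodType K)
  (codiag_l (bicomod_left X) (bicomod_left Y) : {linear _ -> _})
  (codiag_r (bicomod_right X) (bicomod_right Y) : {linear _ -> _}) _ _ _ _ _);
apply: lin_ext => x.
- by apply: codiag_lA => v; [exact: (lin_congr (bclA X) v)|exact: (lin_congr (bclA Y) v)].
- by apply: codiag_l1 => v; [exact: (lin_congr (bcl1 X) v)|exact: (lin_congr (bcl1 Y) v)].
- by apply: codiag_rA => v; [exact: (lin_congr (bcrA X) v)|exact: (lin_congr (bcrA Y) v)].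
- by apply: codiag_r1 => v; [exact: (lin_congr (bcr1 X) v)|exact: (lin_congr (bcr1 Y) v)].
- by apply: codiag_lr => v; [exact: (lin_congr (bclr X) v)|exact: (lin_congr (bclr Y) v)].
Defined.

Lemma triv_lA (k : K^o) :
  tassoc (tmap (hdelta H) (idfun : {linear K^o -> K^o}) (triv_l H k)) =
  tmap (idfun : {linear H -> H}) (@triv_l K H) (triv_l H k).
Proof. by rewrite -[triv_l H k]/(tmk 1 k) !tmapE /= hdelta1 tassocE. Qed.
Lemma triv_l1 (k : K^o) :
  tlunit (tmap (heps H) (idfun : {linear K^o -> K^o}) (triv_l H k)) = k.
Proof. by rewrite /triv_l tmapE /= tlunitE heps1 scale1r. Qed.

Definition bicomod_unit : bcm.
Proof.
refine (@Bicomodule (vect K) (hopf_coalg H) (K^o : lmodType K)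
  (@triv_l K H : {linear _ -> _}) (@triv_r K H : {linear _ -> _}) _ _ _ _ _);
apply: lin_ext => k.
- exact: triv_lA.
- exact: triv_l1.
- change (tassoc (tmap (@triv_r K H) (idfun : {linear H -> H}) (tmk k 1)) =
          tmap (idfun : {linear K^o -> K^o}) (hdelta H) (tmk k 1)).
  by rewrite !tmapE /= hdelta1 /triv_r tassocE.
- change (trunit (tmap (idfun : {linear K^o -> K^o}) (heps H) (tmk k 1)) = k).
  by rewrite tmapE /= trunitE heps1 scale1r.
- change (tassoc (tmap (@triv_l K H) (idfun : {linear H -> H}) (tmk k 1)) =
          tmap (idfun : {linear H -> H}) (@triv_r K H) (tmk 1 k)).
  by rewrite !tmapE /= /triv_l /triv_r tassocE.
Defined.

Lemma bicomod_tensor_hom_subproof (X X' Y Y' : bcm) (f : bicomod_hom X X') (g : bicomod_hom Y Y') :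
  @is_bicomod_hom (vect K) (hopf_coalg H) (bicomod_tensor X Y) (bicomod_tensor X' Y')
    (mtenm (sval f) (sval g)).
Proof.
case: f g => [f [fl fr]] [g [gl gr]]; split; apply: lin_ext => x.
  apply: (codiag_l_nat (lV := bicomod_left X) (lW := bicomod_left Y)
           (lV' := bicomod_left X') (lW' := bicomod_left Y')) => v.
    exact: (lin_congr fl v).
  exact: (lin_congr gl v).
apply: (codiag_r_nat (lV := bicomod_right X) (lW := bicomod_right Y)
           (lV' := bicomod_right X') (lW' := bicomod_right Y')) => v.
  exact: (lin_congr fr v).
exact: (lin_congr gr v).
Qed.

Definition bicomod_tensor_hom (X X' Y Y' : bcm) (f : bicomod_hom X X') (g : bicomod_hom Y Y') :
    bicomod_hom (bicomod_tensor X Y) (bicomod_tensor X' Y') :=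
  exist _ (mtenm (sval f) (sval g)) (bicomod_tensor_hom_subproof f g).

Lemma bicomod_assoc_subproof (X Y Z : bcm) :
  @is_bicomod_hom (vect K) (hopf_coalg H) (bicomod_tensor (bicomod_tensor X Y) Z)
    (bicomod_tensor X (bicomod_tensor Y Z))
    (massoc (bicomob X) (bicomob Y) (bicomob Z)).
Proof.
split; apply: lin_ext => x.
  exact: (codiag_l_assoc (bicomod_left X) (bicomod_left Y) (bicomod_left Z) x).
exact: (codiag_r_assoc (bicomod_right X) (bicomod_right Y) (bicomod_right Z) x).
Qed.

Lemma bicomod_assocV_subproof (X Y Z : bcm) :
  @is_bicomod_hom (vect K) (hopf_coalg H) (bicomod_tensor X (bicomod_tensor Y Z))
    (bicomod_tensor (bicomod_tensor X Y) Z)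
    (massocV (bicomob X) (bicomob Y) (bicomob Z)).
Proof.
apply: inv_bicomod_hom (bicomod_assoc_subproof X Y Z); [exact: massocK|exact: massocVK].
Qed.

Lemma bicomod_lunit_subproof (X : bcm) :
  @is_bicomod_hom (vect K) (hopf_coalg H) (bicomod_tensor bicomod_unit X) X
    (mlunit (bicomob X)).
Proof.
split; apply: lin_ext => x.
  exact: (codiag_l_lunit (bicomod_left X) x).
exact: (codiag_r_lunit (bicomod_right X) x).
Qed.

Lemma bicomod_lunitV_subproof (X : bcm) :
  @is_bicomod_hom (vect K) (hopf_coalg H) X (bicomod_tensor bicomod_unit X)
    (mlunitV (bicomob X)).
Proof.
apply: inv_bicomod_hom (bicomod_lunit_subproof X); [exact: mlunitK|exact: mlunitVK].
Qed.

Lemma bicomod_runit_subproof (X : bcm) :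
  @is_bicomod_hom (vect K) (hopf_coalg H) (bicomod_tensor X bicomod_unit) X
    (mrunit (bicomob X)).
Proof.
split; apply: lin_ext => x.
  exact: (codiag_l_runit (bicomod_left X) x).
exact: (codiag_r_runit (bicomod_right X) x).
Qed.

Lemma bicomod_runitV_subproof (X : bcm) :
  @is_bicomod_hom (vect K) (hopf_coalg H) X (bicomod_tensor X bicomod_unit)
    (mrunitV (bicomob X)).
Proof.
apply: inv_bicomod_hom (bicomod_runit_subproof X); [exact: mrunitK|exact: mrunitVK].
Qed.

(* H-bicomodules over K with codiagonal coactions on the tensor product *)
Definition bicomod_monoidal : monoidal.
Proof.
refine (@Monoidal (bicomod_cat (hopf_coalg H)) bicomod_tensor bicomod_tensor_hom bicomod_unit
  (fun X Y Z => exist _ _ (bicomod_assoc_subproof X Y Z))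
  (fun X Y Z => exist _ _ (bicomod_assocV_subproof X Y Z))
  (fun X => exist _ _ (bicomod_lunit_subproof X))
  (fun X => exist _ _ (bicomod_lunitV_subproof X))
  (fun X => exist _ _ (bicomod_runit_subproof X))
  (fun X => exist _ _ (bicomod_runitV_subproof X))
  _ _ _ _ _ _ _ _ _ _ _ _ _).
- by move=> *; apply: eq_exist; apply: (@mten1 (vect K)).
- by move=> *; apply: eq_exist; apply: (@mtenM (vect K)).
- by move=> *; apply: eq_exist; apply: (@massocK (vect K)).
- by move=> *; apply: eq_exist; apply: (@massocVK (vect K)).
- by move=> *; apply: eq_exist; apply: (@mlunitK (vect K)).
- by move=> *; apply: eq_exist; apply: (@mlunitVK (vect K)).
- by move=> *; apply: eq_exist; apply: (@mrunitK (vect K)).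
- by move=> *; apply: eq_exist; apply: (@mrunitVK (vect K)).
- by move=> *; apply: eq_exist; apply: (@massoc_nat (vect K)).
- by move=> X X' [f hf]; apply: eq_exist; apply: (@mlunit_nat (vect K)).
- by move=> X X' [f hf]; apply: eq_exist; apply: (@mrunit_nat (vect K)).
- by move=> *; apply: eq_exist; apply: (@mpentagon (vect K)).
- by move=> *; apply: eq_exist; apply: (@mtriangle (vect K)).
Defined.

Definition hopf_bicomod : bcm.
Proof.
refine (@Bicomodule (vect K) (hopf_coalg H) (H : lmodType K) (hdelta H) (hdelta H) _ _ _ _ _);
apply: lin_ext => h.
- exact: hdeltaA.
- exact: tlunit_heps.
- exact: hdeltaA.
- exact: trunit_heps.
- exact: hdeltaA.
Defined.

Lemma hmul_bicomod_subproof :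
  @is_bicomod_hom (vect K) (hopf_coalg H) (bicomod_tensor hopf_bicomod hopf_bicomod) hopf_bicomod
    (@hmul K H : {linear tensor H H -> H}).
Proof.
have hm := hmul_bilin H; have tm := tmk_bilin.
have mE g h : hmul (tmk g h) = g * h :> H by apply: (tlift_tmk g h hm).
split; apply: lin_ext => x.
  change (hdelta H (hmul x) = tmap (idfun : {linear H -> H}) (@hmul K H)
    (codiag_l (hdelta H) (hdelta H) x)).
  elim/tens_ind: x => [g h|x y hx hy]; last by rewrite !linearD /= hx hy.
  rewrite mE hdeltaM codiag_lE -[hdelta H g in LHS]tmap_id -[hdelta H h in LHS]tmap_id.
  by apply/esym/(tens2_map hm (tm _ _ _) hm hm).
change (hdelta H (hmul x) = tmap (@hmul K H) (idfun : {linear H -> H})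
    (codiag_r (hdelta H) (hdelta H) x)).
elim/tens_ind: x => [g h|x y hx hy]; last by rewrite !linearD /= hx hy.
rewrite mE hdeltaM codiag_rE -[hdelta H g in LHS]tmap_id -[hdelta H h in LHS]tmap_id.
by apply/esym/(tens2_map (tm _ _ _) hm hm hm).
Qed.

Definition hone (k : K^o) : H := (k : K) *: 1.
Lemma hone_linear : linear hone.
Proof. by move=> a x y; rewrite /hone scalerDl scalerA. Qed.
HB.instance Definition _ := GRing.isLinear.Build K K^o H *:%R hone hone_linear.

Lemma hone_bicomod_subproof :
  @is_bicomod_hom (vect K) (hopf_coalg H) bicomod_unit hopf_bicomod
    (hone : {linear K^o -> H}).
Proof.
split; apply: lin_ext => k.
  change (hdelta H (hone k) = tmap (idfun : {linear H -> H}) hone (tmk 1 k)).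
  by rewrite tmapE /hone linearZ hdelta1 /= tmkZr.
change (hdelta H (hone k) = tmap hone (idfun : {linear H -> H}) (tmk k 1)).
by rewrite tmapE /hone linearZ hdelta1 /= tmkZl.
Qed.

(* H as an algebra in that category, both coactions being the comultiplication *)
Definition hopf_algebra_in : algebra_in bicomod_monoidal.
Proof.
refine (@AlgebraIn bicomod_monoidal hopf_bicomod
  (exist _ _ hmul_bicomod_subproof) (exist _ _ hone_bicomod_subproof) _ _ _);
have mE g h : hmul (tmk g h) = g * h :> H by apply: (tlift_tmk g h (hmul_bilin H)).
- apply: eq_exist; apply: lin_ext => x.
  change (hmul (tmap (@hmul K H) (idfun : {linear H -> H}) x) =
          hmul (tmap (idfun : {linear H -> H}) (@hmul K H) (tassoc x))).
  elim/tens3_ind: x => [a b c|x y hx hy]; last by rewrite !linearD /= hx hy.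
  by rewrite tassocE !tmapE /= !mE mulrA.
- apply: eq_exist; apply: lin_ext => x.
  change (hmul (tmap hone (idfun : {linear H -> H}) x) = tlunit x).
  elim/tens_ind: x => [a b|x y hx hy]; last by rewrite !linearD /= hx hy.
  by rewrite tlunitE !tmapE /= !mE /hone -scalerAl mul1r.
- apply: eq_exist; apply: lin_ext => x.
  change (hmul (tmap (idfun : {linear H -> H}) hone x) = trunit x).
  elim/tens_ind: x => [a b|x y hx hy]; last by rewrite !linearD /= hx hy.
  by rewrite trunitE !tmapE /= !mE /hone -scalerAr mulr1.
Defined.
End BicomodMonoidal.

Section YetterDrinfeld.
Variables (K : fieldType) (H : hopf_algebra K).
Notation lcm := (@lcomodule (vect K) (hopf_coalg H)).

Definition lcoact (V : lcm) :
  {linear (lcomob V : lmodType K) -> tensor H (lcomob V : lmodType K)} := lco V.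

Record ydmod := Ydmod {
  yd_comod :> lcomodule (hopf_coalg H);
  yact : H -> (lcomob yd_comod : lmodType K) -> (lcomob yd_comod : lmodType K);
  yact_bilin : bilin yact;
  yact1 : forall v, yact 1 v = v;
  yactM : forall g h v, yact (g * h) v = yact g (yact h v);
  yd_compat : forall h v,
    lcoact yd_comod (yact h v) =
    sweedler3 (fun h1 h2 h3 : H =>
      tlift (fun v1 v0 => tmk (h1 * v1 * hS H h3) (yact h2 v0)) (lcoact yd_comod v)) h }.

Definition is_yd_hom (V W : ydmod) (f : lcomod_hom V W) : Prop :=
  forall h v, sval f (yact h v) = yact h (sval f v).

Definition yd_hom (V W : ydmod) : Type := {f : lcomod_hom V W | is_yd_hom f}.

Lemma yd_id_subproof (V : ydmod) : @is_yd_hom V V (@idc (lcomod_cat (hopf_coalg H)) (yd_comod V)).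
Proof. by []. Qed.

Lemma yd_comp_subproof (U V W : ydmod) (g : yd_hom V W) (f : yd_hom U V) :
  
  @is_yd_hom U W (@compc (lcomod_cat (hopf_coalg H)) (yd_comod U) (yd_comod V) (yd_comod W)
                    (sval g) (sval f)).
Proof. by case: g f => [g hg] [f hf] h v; rewrite /= hf hg. Qed.

Definition yd_cat : category.
Proof.
refine (@Category ydmod yd_hom (fun V => exist _ _ (@yd_id_subproof V))
  (fun U V W g f => exist _ _ (@yd_comp_subproof U V W g f)) _ _ _).
- by move=> V W [f hf]; apply: eq_exist; exact: (@comp1c (lcomod_cat (hopf_coalg H))).
- by move=> V W [f hf]; apply: eq_exist; exact: (@compc1 (lcomod_cat (hopf_coalg H))).
- move=> X V W Z [h ?] [g ?] [f ?]; apply: eq_exist.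
  exact: (@compcA (lcomod_cat (hopf_coalg H))).
Defined.

Definition forget_yd : functor yd_cat (lcomod_cat (hopf_coalg H)).
Proof.
exact: (@Functor yd_cat (lcomod_cat (hopf_coalg H)) yd_comod
  (fun (V W : ydmod) (f : yd_hom V W) => sval f) (fun _ => erefl) (fun _ _ _ _ _ => erefl)).
Defined.

Definition triv_lcomod : lcm.
Proof.
refine (@Lcomodule (vect K) (hopf_coalg H) (K^o : lmodType K)
  (@triv_l K H : {linear _ -> _}) _ _);
apply: lin_ext => k; [exact: triv_lA|exact: triv_l1].
Defined.

Lemma triv_yd_compat (h : H) (k : K^o) :
  (tmk 1 ((heps H h : K) *: k) : tensor H K^o) =
  sweedler3 (fun h1 h2 h3 : H =>
    tlift (fun (v1 : H) (v0 : K^o) => tmk (h1 * v1 * hS H h3) ((heps H h2 : K) *: v0 : K^o))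
      (tmk 1 k)) h.
Proof.
have inb (a b c : H) : bilin (fun (v1 : H) (v0 : K^o) =>
    tmk (a * v1 * hS H c) ((heps H b : K) *: v0 : K^o)).
  split=> [w x y z|v x y z].
    by rewrite mulrDr mulrDl -scalerAr -scalerAl tmkP.
  by rewrite scalerDr !scalerA [_ * x]mulrC -scalerA tmkPr.
have Sb : bilin (fun g h : H => g * hS H h).
  exact: (bilin_comp idfun (hS H) idfun (hmul_bilin H)).
have Ab (c : H) : bilin (fun a b : H => tmk (a * hS H c) ((heps H b : K) *: k : K^o)).
  split=> [w x y z|v x y z].
    by rewrite mulrDl -scalerAl tmkP.
  by rewrite linearP scalerDl -scalerA tmkPr.
have Ar (x : H) (c : H) :
    tlift (fun a b : H => tmk (a * hS H c) ((heps H b : K) *: k : K^o)) (hdelta H x) =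
    tmk (x * hS H c) k.
  rewrite -{2}[x](heps1r x).
  elim/tens_ind: (hdelta H x) => [a b|d d' hd hd'].
    rewrite !tlift_tmk //; last exact: counit_ract_bilin.
    by rewrite -scalerAl tmkZl tmkZr.
  by rewrite !tliftD // ?mulrDl ?tmkDl ?hd ?hd'; try exact: counit_ract_bilin.
rewrite /sweedler3.
transitivity (tlift (fun x c => tmk (x * hS H c) k) (hdelta H h) : tensor H K^o); last first.
  apply: eq_tlift => x c; rewrite -Ar; apply: eq_tlift => a b.
  by rewrite tlift_tmk // mulr1.
rewrite tmkZr -tmkZl -hSr.
have Tb : bilin (fun x c : H => tmk (x * hS H c) k : tensor H K^o).
  exact: (bilin_comp idfun (hS H) (mklin ((tmk_bilin H K^o).1 k)) (hmul_bilin H)).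
elim/tens_ind: (hdelta H h) => [a b|d d' hd hd']; first by rewrite !tlift_tmk.
by rewrite !tliftD // tmkDl hd hd'.
Qed.

Definition triv_yd : ydmod.
Proof.
refine (@Ydmod triv_lcomod (fun (h : H) (k : K^o) => ((heps H h : K) *: k : K^o))
  (counit_lact_bilin H (K^o : lmodType K)) _ _ triv_yd_compat).
- by move=> v; rewrite heps1 scale1r.
- by move=> g h v; rewrite hepsM scalerA.
Defined.
End YetterDrinfeld.

(* Main.v *)
(* All six assertions are compared with the existence of a separability element: an
   e = e' (x) e'' in H (x) H with he = eh and e'e'' = 1 that is coinvariant for both
   codiagonal H-coactions, i.e. the value at 1 of a section of the multiplication of H as
   an algebra in H-bicomodules. For an ad-coinvariant integral t one can take
   e = t_1 (x) S(t_2). Given e, the forgetful functors are split by averaging: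
   f |-> e' f(e'' x d') d'' (d a second copy of e) for Hopf bicomodules, f |-> e' f(e'' v)
   for Yetter-Drinfeld modules; coinvariance of e makes the averages colinear.
   Conversely a separable functor reflects split epimorphisms, which is applied to the
   multiplication H (x) H -> H, split by h |-> h (x) 1 as a bicomodule map. Finally,
   h |-> h_1 S(h_3) (x) h_2 makes H a Yetter-Drinfeld module over which the counit
   H -> K is split colinear; lifting the identity of K along it gives the integral. *)

From HB Require Import structures.
Require Import Defs.
From mathcomp Require Import all_boot all_algebra.
From mathcomp Require boolp.

Set Implicit Arguments.
Unset Strict Implicit.
Unset Printing Implicit Defensive.

Import GRing.Theory.
Local Open Scope ring_scope.

Notation "\D_ ( a , b <- h ) F" := (tlift (fun a b => F) (hdelta _ h))
  (at level 41, F at level 41, a, b, h at level 50,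
   format "'[' \D_ ( a ,  b  <-  h ) '/  '  F ']'").
Notation "\T_ ( a , b <- x ) F" := (tlift (fun a b => F) x)
  (at level 41, F at level 41, a, b, x at level 50,
   format "'[' \T_ ( a ,  b  <-  x ) '/  '  F ']'").

(** * Linearity, bilinearity and trilinearity side conditions *)

Section Linearity.
Variable K : fieldType.
Implicit Types U V W Z : lmodType K.

(** A constant of its own at the head of the goal, so that the tactic [lin] below can match on the
    body of the function it is applied to. *)
Definition lin V W (f : V -> W) : Prop :=
  forall (a : K) (x y : V), f (a *: x + y) = a *: f x + f y.

Definition trilin U V W Z (f : U -> V -> W -> Z) : Prop :=
  [/\ forall v w, lin (fun u => f u v w), forall u w, lin (fun v => f u v w)
    & forall u v, lin (f u v)].

Lemma lin_id V : lin (fun x : V => x).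
Proof. by []. Qed.

Lemma linZ V W (f : V -> W) a x : lin f -> f (a *: x) = a *: f x.
Proof.
move=> hf; have := hf a x 0; rewrite !addr0 => ->.
by have := hf (-1) 0 0; rewrite scaler0 add0r scaleN1r addNr => ->; rewrite addr0.
Qed.

Lemma lin_linear V W (f : {linear V -> W}) : lin f.
Proof. by move=> a x y; rewrite linearP. Qed.

Lemma lin_comp V W Z (g : {linear W -> Z}) (f : V -> W) : lin f -> lin (fun x => g (f x)).
Proof. by move=> hf a x y; rewrite hf linearP. Qed.

Lemma lin_compf V W Z (g : W -> Z) (f : V -> W) : lin g -> lin f -> lin (fun x => g (f x)).
Proof. by move=> hg hf a x y; rewrite hf hg. Qed.

Lemma lin_bill U V W Z (F : U -> V -> Z) (f : W -> U) v :
  bilin F -> lin f -> lin (fun x => F (f x) v).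
Proof. by move=> hF hf a x y; rewrite hf hF.1. Qed.

Lemma lin_bilr U V W Z (F : U -> V -> Z) (f : W -> V) u :
  bilin F -> lin f -> lin (fun x => F u (f x)).
Proof. by move=> hF hf a x y; rewrite hf hF.2. Qed.

Lemma lin_tri1 U V W Z (X : lmodType K) (F : U -> V -> W -> Z) (f : X -> U) v w :
  trilin F -> lin f -> lin (fun x => F (f x) v w).
Proof. by case=> h _ _ hf a x y; rewrite hf h. Qed.
Lemma lin_tri2 U V W Z (X : lmodType K) (F : U -> V -> W -> Z) (f : X -> V) u w :
  trilin F -> lin f -> lin (fun x => F u (f x) w).
Proof. by case=> _ h _ hf a x y; rewrite hf h. Qed.
Lemma lin_tri3 U V W Z (X : lmodType K) (F : U -> V -> W -> Z) (f : X -> W) u v :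
  trilin F -> lin f -> lin (fun x => F u v (f x)).
Proof. by case=> _ _ h hf a x y; rewrite hf h. Qed.

Lemma lin_scalel V W (f : W -> K^o) (v : V) : lin f -> lin (fun x => (f x : K) *: v).
Proof. by move=> hf a x y; rewrite hf scalerDl scalerA. Qed.
Lemma lin_scaler V W (f : W -> V) (a : K) : lin f -> lin (fun x => a *: f x).
Proof. by move=> hf b x y; rewrite hf scalerDr !scalerA mulrC. Qed.

Lemma lin_tlift_body U V W Z (F : U -> V -> W -> Z) x :
  (forall v w, lin (fun u => F u v w)) -> lin (fun u => tlift (F u) x).
Proof. by move=> hF a u u'; apply: tlift_funP => v w; apply: hF. Qed.
Lemma lin_tlift_arg U V W Z (F : V -> W -> Z) (f : U -> tensor V W) :
  bilin F -> lin f -> lin (fun u => tlift F (f u)).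
Proof. by move=> hF hf a u u'; rewrite hf tlift_linear. Qed.

Lemma bilinP V W Z (f : V -> W -> Z) :
  (forall w, lin (fun v => f v w)) -> (forall v, lin (fun w => f v w)) -> bilin f.
Proof. by move=> h h'; split=> x a y z; [apply: h|apply: h']. Qed.
Lemma trilinP U V W Z (f : U -> V -> W -> Z) :
  (forall v w, lin (fun u => f u v w)) -> (forall u w, lin (fun v => f u v w)) ->
  (forall u v, lin (fun w => f u v w)) -> trilin f.
Proof. by split. Qed.

Lemma lin_mull (A : algType K) W (f : W -> A) b : lin f -> lin (fun x => f x * b).
Proof. by move=> hf a x y; rewrite hf mulrDl scalerAl. Qed.
Lemma lin_mulr (A : algType K) W (f : W -> A) b : lin f -> lin (fun x => b * f x).
Proof. by move=> hf a x y; rewrite hf mulrDr scalerAr. Qed.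

End Linearity.

(* In a pattern such as [fun x => F (@?f x) ?b] the variable [b] may capture [x], so the
   arguments are matched as functions of [x] and then tested for being constant. *)
Ltac lin_pair F hF f g :=
  lazymatch f with
  | (fun _ => ?b) =>
      lazymatch g with
      | (fun _ => ?c) => fail
      | _ => refine (@lin_bilr _ _ _ _ _ F g b hF _)
      end
  | _ => lazymatch g with (fun _ => ?b) => refine (@lin_bill _ _ _ _ _ F f b hF _) end
  end.

(** Descends through the body of the function, with one rule for each operation that is linear in
    the argument where the variable occurs. In a [tlift] the variable sits either in the summand or
    in the tensor; in the second case the summand has to be bilinear. A goal that matches no rule is
    left open. *)
Ltac lin :=
  lazymatch goal with
  | |- bilin _ => apply: bilinP => ? /=; lin
  | |- trilin _ => apply: trilinP => ? ? /=; lin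
  | |- lin (fun x => x) => apply: lin_id
  | |- @lin ?K ?U _ (fun x => @tmk _ ?V ?W (@?f x) (@?g x)) =>
      lin_pair (@tmk K V W) (tmk_bilin V W) f g; lin
  | |- @lin ?K ?U ?A (fun x => @?f x * @?g x) =>
      lazymatch f with
      | (fun _ => ?b) => refine (@lin_mulr K _ U g b _); lin
      | _ => lazymatch g with (fun _ => ?b) => refine (@lin_mull K _ U f b _); lin end
      end
  | |- @lin ?K ?U _ (fun x => @tlift _ ?V ?W ?Z (@?F x) (@?u x)) =>
      lazymatch u with
      | (fun _ => ?b) => refine (@lin_tlift_body K U V W Z F b _) => ? ? /=; lin
      | _ => lazymatch F with
        | (fun _ => ?G) => refine (@lin_tlift_arg K U V W Z G u _ _); lin
        end
      end
  | |- @lin ?K ?U _ (fun x => @GRing.Linear.sort _ ?V ?W _ ?g (@?f x)) =>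
      refine (@lin_comp K U _ _ g f _); lin
  | |- @lin ?K ?U _ (fun x => @?f x *: @?g x) =>
      lazymatch f with
      | (fun _ => ?b) => refine (@lin_scaler K _ U g b _); lin
      | _ => lazymatch g with (fun _ => ?b) => refine (@lin_scalel K _ U f b _); lin end
      end
  | |- @lin ?K ?W ?Z (fun x => @lact _ ?H ?V (@?f x) (@?g x)) =>
      lin_pair (@lact K H V) (lact_bilin V) f g; lin
  | |- @lin ?K ?W ?Z (fun x => @ract _ ?H ?V (@?f x) (@?g x)) =>
      lin_pair (@ract K H V) (ract_bilin V) f g; lin
  | |- @lin ?K ?W ?Z (fun x => @yact _ ?H ?V (@?f x) (@?g x)) =>
      lin_pair (@yact K H V) (yact_bilin V) f g; lin
  | |- lin (fun _ => _) => lin_hyp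
  | |- @lin ?K ?U ?V ?F => change (@lin K U V (fun x => F x)); lin
  | |- _ => idtac
  end
with lin_hyp :=
  match goal with
  | hF : @lin _ _ _ ?F |- @lin ?K ?W ?Z (fun x => ?F (@?f x)) =>
      refine (@lin_compf K W _ Z F f hF _); lin
  | hF : @bilin _ _ _ _ ?F |- @lin ?K ?W ?Z (fun x => ?F (@?f x) (@?g x)) =>
      lin_pair F hF f g; lin
  | hF : @trilin _ _ _ _ _ ?F |- @lin ?K ?W ?Z (fun x => ?F (@?f x) (@?g x) (@?h x)) =>
      lazymatch f with
      | (fun _ => ?b) =>
          lazymatch g with
          | (fun _ => ?c) => refine (@lin_tri3 K _ _ _ Z W F h b c hF _); lin
          | _ =>
              lazymatch h with
              | (fun _ => ?c) => refine (@lin_tri2 K _ _ _ Z W F g b c hF _); lin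
              end
          end
      | _ => lazymatch g with (fun _ => ?b) => lazymatch h with (fun _ => ?c) =>
               refine (@lin_tri1 K _ _ _ Z W F f b c hF _); lin end end
      end
  (* Last resort: [F] is taken to be a linear map whose structure is found by unification. *)
  | |- @lin ?K ?U ?Z (fun x => ?F (@?f x)) =>
      refine (@lin_compf K U _ Z F f _ _); [exact: lin_linear|lin]
  | |- _ => idtac
  end.

(** * Moving linear maps and sums through [tlift] *)

Section TensorLift.
Variable K : fieldType.
Implicit Types U V W Z : lmodType K.

(** [tlift] is a finite sum over a chosen representative, and a linear map commutes with finite
    sums. *)
Lemma lin_tlift V W Z Z' (g : Z -> Z') (f : V -> W -> Z) x :
  lin g -> g (tlift f x) = \T_(v, w <- x) g (f v w).
Proof.
by move=> hg; have := linear_sum (mklin hg); apply.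
Qed.

Lemma tlift_exch V W V' W' Z (f : V -> W -> V' -> W' -> Z) x y :
  \T_(v, w <- x) \T_(v', w' <- y) f v w v' w' =
  \T_(v', w' <- y) \T_(v, w <- x) f v w v' w'.
Proof. exact: exchange_big. Qed.

(** Chosen representatives do not add up, so the outer map has to factor through the tensor product:
    bilinearity of [f] makes [tlift f] linear. *)
Lemma tlift_tlift V W V' W' Z (f : V' -> W' -> Z) (g : V -> W -> tensor V' W') x :
  bilin f -> tlift f (tlift g x) = \T_(v, w <- x) tlift f (g v w).
Proof. by move=> hf; apply: lin_tlift; apply: tlift_linear. Qed.

Lemma tmk_tlift V W (x : tensor V W) : \T_(v, w <- x) tmk v w = x.
Proof. by rewrite [RHS]tens_sum. Qed.

Lemma tlift_tmap V V' W W' Z (f : V' -> W' -> Z) (g : {linear V -> V'})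
    (h : {linear W -> W'}) x :
  bilin f -> tlift f (tmap g h x) = \T_(v, w <- x) f (g v) (h w).
Proof.
move=> hf; rewrite /tmap tlift_tlift //; apply: eq_tlift => v w; exact: tlift_tmk.
Qed.

End TensorLift.

(** * Sweedler calculus and identities for the antipode *)

Section Sweedler.
Variables (K : fieldType) (H : hopf_algebra K).
Implicit Types (Z : lmodType K) (h : H).

(** The two sides evaluate [f] on the two sides of [hdeltaA]; trilinearity allows the reduction to
    pure tensors. *)
Lemma coassoc Z (f : H -> H -> H -> Z) h : trilin f ->
  \D_(x, c <- h) \D_(a, b <- x) f a b c = \D_(a, x <- h) \D_(b, c <- x) f a b c.
Proof.
move=> hf; transitivity (\T_(a, u <- tmap (idfun : {linear H -> H}) (hdelta H) (hdelta H h))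
  \T_(b, c <- u) f a b c); last by rewrite tlift_tmap //; lin.
rewrite -hdeltaA.
elim/tens_ind: (hdelta H h) => [x c|x y hx hy].
  rewrite tlift_tmk; last lin.
  rewrite tmapE /=; elim/tens_ind: (hdelta H x) => [a b|u v hu hv].
    by rewrite tassocE !tlift_tmk //; lin.
  by rewrite tmkDl linearD /= !tliftD ?hu ?hv //; lin.
by rewrite !linearD /= !tliftD ?hx ?hy //; lin.
Qed.

Lemma counitl Z (f : H -> Z) h : lin f -> \D_(a, b <- h) ((heps H a : K) *: f b) = f h.
Proof.
move=> hf; rewrite -[in RHS](heps1l h) (lin_tlift _ _ hf); apply: eq_tlift => a b.
by rewrite linZ.
Qed.

Lemma counitr Z (f : H -> Z) h : lin f -> \D_(a, b <- h) ((heps H b : K) *: f a) = f h.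
Proof.
move=> hf; rewrite -[in RHS](heps1r h) (lin_tlift _ _ hf); apply: eq_tlift => a b.
by rewrite linZ.
Qed.

Lemma antipodel Z (f : H -> Z) h : lin f ->
  \D_(a, b <- h) f (hS H a * b) = (heps H h : K) *: f 1.
Proof. by move=> hf; rewrite -(lin_tlift _ _ hf) hSl linZ. Qed.

Lemma antipoder Z (f : H -> Z) h : lin f ->
  \D_(a, b <- h) f (a * hS H b) = (heps H h : K) *: f 1.
Proof. by move=> hf; rewrite -(lin_tlift _ _ hf) hSr linZ. Qed.

(** Regrouping by coassociativity turns $S(a)b$ into a counit, which the neighbouring leg absorbs.
    In the names of this lemma and the next three, the first part tells which slot of [f] receives
    the contracted product, the suffix which factor carries the antipode. *)
Lemma contractl_Sl Z (f : H -> H -> Z) h : bilin f ->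
  \D_(a, y <- h) \D_(b, c <- y) f (hS H a * b) c = f 1 h.
Proof.
move=> hf; rewrite -coassoc; last lin.
transitivity (\D_(x, c <- h) ((heps H x : K) *: f 1 c)); last by apply: counitl; lin.
by apply: eq_tlift => x c; apply: (@antipodel _ (fun u => f u c)); lin.
Qed.

Lemma contractl_Sr Z (f : H -> H -> Z) h : bilin f ->
  \D_(a, y <- h) \D_(b, c <- y) f (a * hS H b) c = f 1 h.
Proof.
move=> hf; rewrite -coassoc; last lin.
transitivity (\D_(x, c <- h) ((heps H x : K) *: f 1 c)); last by apply: counitl; lin.
by apply: eq_tlift => x c; apply: (@antipoder _ (fun u => f u c)); lin.
Qed.

Lemma contractr_Sl Z (f : H -> H -> Z) h : bilin f ->
  \D_(a, y <- h) \D_(b, c <- y) f a (hS H b * c) = f h 1.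
Proof.
move=> hf; transitivity (\D_(a, y <- h) ((heps H y : K) *: f a 1)); last by apply: counitr; lin.
by apply: eq_tlift => a y; apply: antipodel; lin.
Qed.

Lemma contractr_Sr Z (f : H -> H -> Z) h : bilin f ->
  \D_(a, y <- h) \D_(b, c <- y) f a (b * hS H c) = f h 1.
Proof.
move=> hf; transitivity (\D_(a, y <- h) ((heps H y : K) *: f a 1)); last by apply: counitr; lin.
by apply: eq_tlift => a y; apply: antipoder; lin.
Qed.

Lemma tlift_deltaM Z (f : H -> H -> Z) g h : bilin f ->
  tlift f (hdelta H (g * h)) = \D_(a, b <- g) \D_(c, d <- h) f (a * c) (b * d).
Proof.
move=> hf; rewrite hdeltaM /tens2 tlift_tlift //; apply: eq_tlift => a b.
by rewrite tlift_tlift //; apply: eq_tlift => c d; rewrite tlift_tmk.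
Qed.

Lemma tlift_delta1 Z (f : H -> H -> Z) : bilin f -> tlift f (hdelta H 1) = f 1 1.
Proof. by move=> hf; rewrite hdelta1 tlift_tmk. Qed.

Lemma antipode1 : hS H 1 = 1.
Proof.
have := hSl (1 : H); rewrite tlift_delta1; last lin.
by rewrite mulr1 heps1 scale1r.
Qed.

(** Both sides arise from $S(h_1)S(g_1)g_2h_2S(g_3h_3)$: cancelling from the left leaves $S(gh)$,
    while contracting $g_2h_2$ with its antipode leaves $S(h)S(g)$. *)
Lemma antipodeM g h : hS H (g * h) = hS H h * hS H g.
Proof.
transitivity (\D_(g1, y <- g) \D_(h1, z <- h)
    hS H h1 * hS H g1 * (\D_(c, d <- y * z) (c * hS H d))); last first.
  rewrite -[RHS](@counitr _ (fun g => hS H h * hS H g)); last lin.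
  apply: eq_tlift => g1 y.
  rewrite -(@counitr _ (fun h => hS H h * hS H g1)); last lin.
  rewrite (@lin_tlift _ _ _ _ _ (fun u => _ *: u)); last lin.
  apply: eq_tlift => h1 z; rewrite hSr hepsM -scalerA -!scalerAr mulr1 //.
transitivity (\D_(g1, y <- g) \D_(g2, g3 <- y) \D_(h1, z <- h) \D_(h2, h3 <- z)
    (hS H h1 * (hS H g1 * g2) * h2 * hS H (g3 * h3))).
  rewrite (@contractl_Sl _ (fun u v => \D_(h1, z <- h) \D_(h2, h3 <- z)
    (hS H h1 * u * h2 * hS H (v * h3)))); last lin.
  rewrite -[LHS]mul1r -(@contractl_Sl _ (fun u v => u * hS H (g * v)) h); last lin.
  by apply: eq_tlift => a y; apply: eq_tlift => b c; rewrite mulr1.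
apply: eq_tlift => g1 y; rewrite tlift_exch; apply: eq_tlift => h1 z.
rewrite tlift_deltaM; last lin.
rewrite (@lin_tlift _ _ _ _ _ (fun u => _ * u)); last lin.
apply: eq_tlift => g2 g3.
rewrite (@lin_tlift _ _ _ _ _ (fun u => _ * u)); last lin.
by apply: eq_tlift => h2 h3; rewrite !mulrA.
Qed.

(** Apply the counit, which is multiplicative, to $S(h_1)h_2=\varepsilon(h)1$. *)
Lemma counit_antipode h : heps H (hS H h) = heps H h.
Proof.
transitivity (\D_(a, b <- h) ((heps H b : K) *: heps H (hS H a))); first by rewrite counitr //; lin.
transitivity (\D_(a, b <- h) (heps H (hS H a * b) : K^o)).
  by apply: eq_tlift => a b; rewrite hepsM mulrC.
by rewrite antipodel ?heps1 /GRing.scale /= ?mulr1 //; lin.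
Qed.

Definition tmul (x y : tensor H H) : tensor H H := tens2 *%R *%R x y.
Lemma tmul_bilin : bilin tmul.
Proof. exact: tens2_bilin (hmul_bilin H) (hmul_bilin H). Qed.
Lemma tmulE a b c d : tmul (tmk a b) (tmk c d) = tmk (a * c) (b * d).
Proof. exact: tens2E (hmul_bilin H) (hmul_bilin H) _ _ _ _. Qed.

Lemma tmulA : associative tmul.
Proof.
have tb := tmul_bilin.
move=> x y z; elim/tens_ind: x => [a a'|x x' hx hx']; last first.
  by rewrite !(bilinDl tb) hx hx'.
elim/tens_ind: y => [b b'|y y' hy hy']; last first.
  by rewrite (bilinDl tb) !(bilinDr tb) (bilinDl tb) hy hy'.
elim/tens_ind: z => [c c'|z z' hz hz']; last first.
  by rewrite !(bilinDr tb) hz hz'.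
by rewrite !tmulE !mulrA.
Qed.
Lemma tmul1l x : tmul (tmk 1 1) x = x.
Proof.
elim/tens_ind: x => [c c'|z z' hz hz']; first by rewrite tmulE !mul1r.
by rewrite (bilinDr tmul_bilin) hz hz'.
Qed.
Lemma tmul1r x : tmul x (tmk 1 1) = x.
Proof.
elim/tens_ind: x => [c c'|z z' hz hz']; first by rewrite tmulE !mulr1.
by rewrite (bilinDl tmul_bilin) hz hz'.
Qed.

(* Both sides are convolution inverses of the comultiplication in Hom(H, H (x) H). *)
Lemma delta_antipode h : hdelta H (hS H h) = \D_(a, b <- h) tmk (hS H b) (hS H a).
Proof.
have tb := tmul_bilin.
pose tw (h : H) := \D_(a, b <- h) tmk (hS H b) (hS H a).
have twl : lin tw by rewrite /tw; lin.
(* [tw] is a left convolution inverse: among four legs the inner pair $S(x_2)x_3$ cancels first,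
   then $S(x_1)x_4$. *)
have twD (x : H) : \D_(a, b <- x) tmul (tw a) (hdelta H b) = (heps H x : K) *: tmk (1 : H) (1 : H).
  transitivity (\D_(y, b <- x) \D_(a1, a2 <- y) \D_(b1, b2 <- b)
      tmk (hS H a2 * b1) (hS H a1 * b2)).
    apply: eq_tlift => a b; rewrite /tw (@lin_tlift _ _ _ _ _ (fun u => tmul u _)); last lin.
    apply: eq_tlift => a1 a2; rewrite -{1}[hdelta H b]tmk_tlift lin_tlift; last lin.
    by apply: eq_tlift => b1 b2; rewrite tmulE.
  rewrite coassoc; last lin.
  transitivity (\D_(a1, y <- x) tmk (1 : H) (hS H a1 * y)); last by rewrite antipodel //; lin.
  apply: eq_tlift => a1 y.
  by rewrite (@contractl_Sl _ (fun u v => tmk u (hS H a1 * v))) //; lin.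
(* $\Delta\circ S$ is a right inverse because $\Delta(b)\Delta(S(c))=\Delta(bS(c))$; the triple
   convolution of [tw], $\Delta$ and $\Delta\circ S$ is computed both ways. *)
transitivity (\D_(a, y <- h) \D_(b, c <- y) tmul (tw a) (hdelta H (b * hS H c))); last first.
  rewrite (@contractr_Sr _ (fun a u => tmul (tw a) (hdelta H u))); last lin.
  by rewrite hdelta1 tmul1r.
transitivity (\D_(x, c <- h) \D_(a, b <- x) tmul (tmul (tw a) (hdelta H b)) (hdelta H (hS H c))).
  rewrite -[LHS](@counitl _ (fun h => hdelta H (hS H h))); last lin.
  apply: eq_tlift => x c; rewrite -(@lin_tlift _ _ _ _ _ (fun u => tmul u _)); last lin.
  by rewrite twD (bilin_Zl tb) tmul1l.
rewrite coassoc; last lin.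
by do 2!apply: eq_tlift => ? ?; rewrite hdeltaM tmulA.
Qed.

End Sweedler.

(** * Separability elements, and how an integral yields one *)

Section SeparabilityElement.
Variables (K : fieldType) (H : hopf_algebra K).
Implicit Types (Z : lmodType K) (e : tensor H H).

(* The value at 1 of an H-bilinear H-bicolinear section of the multiplication. *)
Definition separability_element e : Prop :=
  [/\ forall h : H, \T_(a, b <- e) tmk (h * a) b = \T_(a, b <- e) tmk a (b * h),
      \T_(a, b <- e) (a * b) = 1,
      codiag_l (hdelta H) (hdelta H) e = tmk 1 e
    & codiag_r (hdelta H) (hdelta H) e = tmk e 1].

Lemma tlift_codiag_l Z (f : H -> H -> H -> Z) e : trilin f ->
  \T_(h, u <- codiag_l (hdelta H) (hdelta H) e) \T_(a, b <- u) f h a b =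
  \T_(a, b <- e) \D_(a1, a2 <- a) \D_(b1, b2 <- b) f (a1 * b1) a2 b2.
Proof.
move=> hf; rewrite /codiag_l tlift_tlift; last lin.
apply: eq_tlift => a b; rewrite /tens2 tlift_tlift; last lin.
apply: eq_tlift => a1 a2; rewrite tlift_tlift; last lin.
by apply: eq_tlift => b1 b2; rewrite !tlift_tmk //; lin.
Qed.

Lemma tlift_codiag_r Z (f : H -> H -> H -> Z) e : trilin f ->
  \T_(u, h <- codiag_r (hdelta H) (hdelta H) e) \T_(a, b <- u) f a b h =
  \T_(a, b <- e) \D_(a1, a2 <- a) \D_(b1, b2 <- b) f a1 b1 (a2 * b2).
Proof.
move=> hf; rewrite /codiag_r tlift_tlift; last lin.
apply: eq_tlift => a b; rewrite /tens2 tlift_tlift; last lin.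
apply: eq_tlift => a1 a2; rewrite tlift_tlift; last lin.
by apply: eq_tlift => b1 b2; rewrite !tlift_tmk //; lin.
Qed.

Section Consequences.
Variable e : tensor H H.
Hypothesis he : separability_element e.

(** The clauses of [separability_element] are plain equalities; here and in the next three lemmas a
    multilinear map is applied to them, which is the form needed inside an average. *)
Lemma sepelt_comm Z (f : H -> H -> Z) h : bilin f ->
  \T_(a, b <- e) f (h * a) b = \T_(a, b <- e) f a (b * h).
Proof.
move=> hf; case: he => /(_ h) /(congr1 (tlift f)) + _ _ _.
rewrite !tlift_tlift // => eq.
by etransitivity; [etransitivity; [|exact: eq]|]; apply: eq_tlift => a b; rewrite tlift_tmk.
Qed.

Lemma sepelt_mul Z (f : H -> Z) : lin f -> \T_(a, b <- e) f (a * b) = f 1.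
Proof. by move=> hf; case: he => _ <- _ _; rewrite (lin_tlift _ _ hf). Qed.

Lemma sepelt_codiag_l Z (f : H -> H -> H -> Z) : trilin f ->
  \T_(a, b <- e) \D_(a1, a2 <- a) \D_(b1, b2 <- b) f (a1 * b1) a2 b2 =
  \T_(a, b <- e) f 1 a b.
Proof.
by move=> hf; case: he => _ _ h _; rewrite -tlift_codiag_l // h tlift_tmk //; lin.
Qed.

Lemma sepelt_codiag_r Z (f : H -> H -> H -> Z) : trilin f ->
  \T_(a, b <- e) \D_(a1, a2 <- a) \D_(b1, b2 <- b) f a1 b1 (a2 * b2) =
  \T_(a, b <- e) f a b 1.
Proof.
by move=> hf; case: he => _ _ _ h; rewrite -tlift_codiag_r // h tlift_tmk //; lin.
Qed.
End Consequences.

(** $he=eh$ rests on $ht=\varepsilon(h)t$, the product of the legs is $\varepsilon(t)$, left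
    coinvariance rests on $ad$-coinvariance of $t$, and right coinvariance on cancelling two inner
    legs. *)
Lemma integral_sepelt (t : H) : ad_coinvariant_integral t ->
  separability_element (\D_(a, b <- t) tmk a (hS H b)).
Proof.
case=> tl tc t1; split.
- move=> h; rewrite !tlift_tlift; try lin.
  transitivity (\D_(a, b <- t) tmk (h * a) (hS H b)).
    by apply: eq_tlift => a b; rewrite tlift_tmk //; lin.
  (* The factor $S(h_2)h_3$ is inserted because $S(b)S(h_2)=S(h_2b)$: the pair $h_1a$, $h_2b$ then
     comes from the coproduct of a leg of $h$ times $t$, where the integral property applies. *)
  transitivity (\D_(a, b <- t) \D_(h1, y <- h) \D_(h2, h3 <- y)
      tmk (h1 * a) (hS H b * (hS H h2 * h3))).
    apply: eq_tlift => a b; apply/esym.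
    rewrite (@contractr_Sl _ _ _ (fun u v => tmk (u * a) (hS H b * v))) ?mulr1 //; lin.
  rewrite tlift_exch.
  transitivity (\D_(h1, y <- h) \D_(h2, h3 <- y) \D_(a, b <- t)
      tmk (h1 * a) (hS H (h2 * b) * h3)).
    apply: eq_tlift => h1 y; rewrite tlift_exch; apply: eq_tlift => h2 h3.
    by apply: eq_tlift => a b; rewrite antipodeM mulrA.
  rewrite -coassoc; last lin.
  transitivity (\D_(x, y <- h) ((heps H x : K) *: \D_(a, b <- t) tmk a (hS H b * y))).
    apply: eq_tlift => x y.
    rewrite -(tlift_deltaM (f := fun u v => tmk u (hS H v * y))); last lin.
    by rewrite tl linearZ tliftZ //; lin.
  rewrite counitl; last lin.
  by apply: eq_tlift => a b; rewrite tlift_tmk //; lin.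
- rewrite tlift_tlift; last lin.
  transitivity (\D_(a, b <- t) (a * hS H b)); last by rewrite hSr t1 scale1r.
  by apply: eq_tlift => a b; rewrite tlift_tmk //; lin.
(* Splitting the second factor of [tc] by the coproduct and applying $S$ to its last leg gives
   $t_1S(t_4)\otimes t_2\otimes S(t_3)=1\otimes t_1\otimes S(t_2)$. *)
- have := congr1 (tlift (fun p q => \D_(q1, q2 <- q) tmk p (tmk q1 (hS H q2)))) tc.
  rewrite tlift_tmk; last lin.
  rewrite -(lin_tlift (g := tmk 1)); last lin.
  move=> <-; rewrite /sweedler3 tlift_tlift; last lin.
  transitivity (\D_(a, b <- t) \D_(b1, b2 <- b) \D_(a1, a2 <- a)
      tmk (a1 * hS H b2) (tmk a2 (hS H b1))).
    rewrite lin_tlift; last by move=> ? ? ?; exact: linearP.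
    apply: eq_tlift => a b; rewrite codiag_lE delta_antipode /tens2 tlift_exch.
    rewrite tlift_tlift; last lin.
    by apply: eq_tlift => b1 b2; rewrite tlift_tmk //; lin.
  rewrite -coassoc; last lin.
  apply: eq_tlift => x c; rewrite coassoc; last lin.
  rewrite tlift_tlift; last lin.
  apply: eq_tlift => a y; rewrite tlift_tmk //; lin.
- transitivity (\D_(a, b <- t) \D_(a1, a2 <- a) \D_(b1, b2 <- b)
      tmk (tmk a1 (hS H b2)) (a2 * hS H b1)).
    (* The right coaction of $t_1\otimes S(t_2)$ is $t_1\otimes S(t_4)\otimes t_2S(t_3)$, whose last
       factor collapses. *)
    rewrite lin_tlift; last by move=> ? ? ?; exact: linearP.
    apply: eq_tlift => a b; rewrite codiag_rE delta_antipode /tens2.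
    apply: eq_tlift => a1 a2; rewrite tlift_tlift; last lin.
    by apply: eq_tlift => b1 b2; rewrite tlift_tmk //; lin.
  rewrite coassoc; last lin.
  rewrite (lin_tlift (g := fun u => tmk u 1)); last lin.
  apply: eq_tlift => a y.
  by rewrite (@contractl_Sr _ _ _ (fun u v => tmk (tmk a (hS H v)) u)) //; lin.
Qed.

End SeparabilityElement.

(** * Averaging linear maps between Hopf bimodules *)

Section Averaging.
Variables (K : fieldType) (H : hopf_algebra K) (e : tensor H H).
Hypothesis he : separability_element e.

Definition lavg (V W : hbimod H) (f : {linear V -> W}) (v : V) : W :=
  \T_(a, b <- e) lact a (f (lact b v)).
Definition ravg (V W : hbimod H) (f : {linear V -> W}) (v : V) : W :=
  \T_(a, b <- e) ract (f (ract v a)) b.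

Lemma lavg_linear (V W : hbimod H) (f : {linear V -> W}) : linear (lavg f).
Proof. by change (lin (lavg f)); rewrite /lavg; lin. Qed.
Lemma ravg_linear (V W : hbimod H) (f : {linear V -> W}) : linear (ravg f).
Proof. by change (lin (ravg f)); rewrite /ravg; lin. Qed.
HB.instance Definition _ (V W : hbimod H) (f : {linear V -> W}) :=
  GRing.isLinear.Build K V W *:%R (lavg f) (lavg_linear f).
HB.instance Definition _ (V W : hbimod H) (f : {linear V -> W}) :=
  GRing.isLinear.Build K V W *:%R (ravg f) (ravg_linear f).

Lemma lavg_lact (V W : hbimod H) (f : {linear V -> W}) h v :
  lavg f (lact h v) = lact h (lavg f v).
Proof.
rewrite [RHS]lin_tlift; last lin.
transitivity (\T_(a, b <- e) lact (h * a) (f (lact b v))); last first.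
  by apply: eq_tlift => a b; rewrite lactM.
rewrite (sepelt_comm he (f := fun a b => lact a (f (lact b v)))); last lin.
by apply: eq_tlift => a b; rewrite lactM.
Qed.

Lemma ravg_ract (V W : hbimod H) (f : {linear V -> W}) v h :
  ravg f (ract v h) = ract (ravg f v) h.
Proof.
rewrite [RHS](lin_tlift (g := fun u => ract u h)); last lin.
transitivity (\T_(a, b <- e) ract (f (ract v (h * a))) b).
  by apply: eq_tlift => a b; rewrite ractM.
rewrite (sepelt_comm he (f := fun a b => ract (f (ract v a)) b)); last lin.
by apply: eq_tlift => a b; rewrite ractM.
Qed.

(** Preserving right linearity is what allows the two averages to be applied in succession. *)
Lemma lavg_ract (V W : hbimod H) (f : {linear V -> W}) v h :
  (forall v, f (ract v h) = ract (f v) h) -> lavg f (ract v h) = ract (lavg f v) h.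
Proof.
move=> hf; rewrite [RHS](lin_tlift (g := fun u => ract u h)); last lin.
by apply: eq_tlift => a b; rewrite -lractC hf lractC.
Qed.

Lemma lavg_id (V W : hbimod H) (f : {linear V -> W}) v :
  (forall h v, f (lact h v) = lact h (f v)) -> lavg f v = f v.
Proof.
move=> hf; rewrite -[RHS]lact1 -(sepelt_mul he (f := fun h => lact h (f v))); last lin.
by apply: eq_tlift => a b; rewrite hf lactM.
Qed.
Lemma ravg_id (V W : hbimod H) (f : {linear V -> W}) v :
  (forall v h, f (ract v h) = ract (f v) h) -> ravg f v = f v.
Proof.
move=> hf; rewrite -[RHS]ract1 -(sepelt_mul he (f := ract (f v))); last lin.
by apply: eq_tlift => a b; rewrite hf ractM.
Qed.

(** Supplies the naturality of the retraction: linear maps on either side slide past the legs of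
    [e]. *)
Lemma lavg_comp (V V' W W' : hbimod H) (g : {linear W -> W'}) (f : {linear V' -> V})
    (u : {linear V -> W}) v :
  (forall h w, g (lact h w) = lact h (g w)) -> (forall h v, f (lact h v) = lact h (f v)) ->
  lavg (g \o u \o f) v = g (lavg u (f v)).
Proof.
move=> hg hf; rewrite [RHS]lin_tlift; last lin.
by apply: eq_tlift => a b; rewrite /= hf hg.
Qed.
Lemma ravg_comp (V V' W W' : hbimod H) (g : {linear W -> W'}) (f : {linear V' -> V})
    (u : {linear V -> W}) v :
  (forall w h, g (ract w h) = ract (g w) h) -> (forall v h, f (ract v h) = ract (f v) h) ->
  ravg (g \o u \o f) v = g (ravg u (f v)).
Proof.
move=> hg hf; rewrite [RHS]lin_tlift; last lin.
by apply: eq_tlift => a b; rewrite /= hf hg.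
Qed.

Section Colinearity.
Variables (C V W : hbimod H) (f : {linear V -> W}).

Section Left.
Variables (rV : {linear V -> tensor C V}) (rW : {linear W -> tensor C W}).
Hypothesis rVl : @is_hbimod_hom K H V (hbimod_tensor C V) rV.
Hypothesis rWl : @is_hbimod_hom K H W (hbimod_tensor C W) rW.
Hypothesis hf : forall v, rW (f v) = tmap idfun f (rV v).

(** The coactions being [H]-linear for the diagonal action, that of $e'f(e''v)$ is
    $e'_1e''_1v_{-1}\otimes e'_2f(e''_2v_0)$, and left coinvariance of [e] replaces $e'_1e''_1$ by
    $1$. In the next three lemmas too, the side of the coaction, not that of the average, decides
    which coinvariance is used. *)
Lemma lavg_colinear_l v : rW (lavg f v) = tmap idfun (lavg f) (rV v).
Proof.
have lC := lact_bilin C; have lV := lact_bilin V; have lW := lact_bilin W.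
have bV := tens2_bilin lC lV; have bW := tens2_bilin lC lW.
transitivity (\T_(a, b <- e) (tens2 (@lact K H C) (@lact K H W) (hdelta H a)
    (tmap idfun f (tens2 (@lact K H C) (@lact K H V) (hdelta H b) (rV v))))).
  rewrite lin_tlift; last lin.
  by apply: eq_tlift => a b; rewrite rWl.1 hf rVl.1.
elim/tens_ind: (rV v) => [c x|x y hx hy]; last first.
  (* The scalar 1 gives the sum the shape required by [tlift_funP]. *)
  rewrite [RHS]linearD /= -hx -hy -[X in _ = X + _]scale1r; apply: tlift_funP => a b.
  by rewrite (bilinDr bV) linearD (bilinDr bW) scale1r.
transitivity (\T_(a, b <- e) \D_(a1, a2 <- a) \D_(b1, b2 <- b)
    tmk (lact (a1 * b1) c) (lact a2 (f (lact b2 x)))).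
  apply: eq_tlift => a b; apply: eq_tlift => a1 a2.
  rewrite /tens2 tlift_tmap; last lin.
  rewrite tlift_tlift; last lin.
  by apply: eq_tlift => b1 b2; rewrite !tlift_tmk /= ?lactM //; lin.
rewrite (sepelt_codiag_l he (f := fun p q r => tmk (lact p c) (lact q (f (lact r x)))));
  last lin.
by rewrite tmapE lact1 -(lin_tlift (g := tmk c)) //; lin.
Qed.

Lemma ravg_colinear_l v : rW (ravg f v) = tmap idfun (ravg f) (rV v).
Proof.
have bV := tens2_bilin (ract_bilin C) (ract_bilin V).
have bW := tens2_bilin (ract_bilin C) (ract_bilin W).
transitivity (\T_(a, b <- e) (tens2 (@ract K H C) (@ract K H W)
    (tmap idfun f (tens2 (@ract K H C) (@ract K H V) (rV v) (hdelta H a))) (hdelta H b))).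
  rewrite lin_tlift; last lin.
  by apply: eq_tlift => a b; rewrite rWl.2 hf rVl.2.
elim/tens_ind: (rV v) => [c x|x y hx hy]; last first.
  rewrite [RHS]linearD /= -hx -hy -[X in _ = X + _]scale1r; apply: tlift_funP => a b.
  by rewrite (bilinDl bV) linearD (bilinDl bW) scale1r.
transitivity (\T_(a, b <- e) \D_(a1, a2 <- a) \D_(b1, b2 <- b)
    tmk (ract c (a1 * b1)) (ract (f (ract x a2)) b2)).
  apply: eq_tlift => a b; rewrite /tens2 tlift_tmap; last lin.
  rewrite tlift_tlift; last lin.
  rewrite tlift_tmk; last lin.
  rewrite tlift_tlift; last lin.
  apply: eq_tlift => a1 a2; rewrite tlift_tmk; last lin.
  by apply: eq_tlift => b1 b2; rewrite ractM.
rewrite (sepelt_codiag_l he (f := fun p q r => tmk (ract c p) (ract (f (ract x q)) r)));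
  last lin.
by rewrite tmapE ract1 -(lin_tlift (g := tmk c)) //; lin.
Qed.
End Left.

Section Right.
Variables (rV : {linear V -> tensor V C}) (rW : {linear W -> tensor W C}).
Hypothesis rVl : @is_hbimod_hom K H V (hbimod_tensor V C) rV.
Hypothesis rWl : @is_hbimod_hom K H W (hbimod_tensor W C) rW.
Hypothesis hf : forall v, rW (f v) = tmap f idfun (rV v).

Lemma lavg_colinear_r v : rW (lavg f v) = tmap (lavg f) idfun (rV v).
Proof.
have bV := tens2_bilin (lact_bilin V) (lact_bilin C).
have bW := tens2_bilin (lact_bilin W) (lact_bilin C).
transitivity (\T_(a, b <- e) (tens2 (@lact K H W) (@lact K H C) (hdelta H a)
    (tmap f idfun (tens2 (@lact K H V) (@lact K H C) (hdelta H b) (rV v))))).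
  rewrite lin_tlift; last lin.
  by apply: eq_tlift => a b; rewrite rWl.1 hf rVl.1.
elim/tens_ind: (rV v) => [x c|x y hx hy]; last first.
  rewrite [RHS]linearD /= -hx -hy -[X in _ = X + _]scale1r; apply: tlift_funP => a b.
  by rewrite (bilinDr bV) linearD (bilinDr bW) scale1r.
transitivity (\T_(a, b <- e) \D_(a1, a2 <- a) \D_(b1, b2 <- b)
    tmk (lact a1 (f (lact b1 x))) (lact (a2 * b2) c)).
  apply: eq_tlift => a b; apply: eq_tlift => a1 a2.
  rewrite /tens2 tlift_tmap; last lin.
  rewrite tlift_tlift; last lin.
  by apply: eq_tlift => b1 b2; rewrite !tlift_tmk /= ?lactM //; lin.
rewrite (sepelt_codiag_r he (f := fun p q r => tmk (lact p (f (lact q x))) (lact r c)));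
  last lin.
by rewrite tmapE lact1 -(lin_tlift (g := fun u => tmk u c)) //; lin.
Qed.

Lemma ravg_colinear_r v : rW (ravg f v) = tmap (ravg f) idfun (rV v).
Proof.
have bV := tens2_bilin (ract_bilin V) (ract_bilin C).
have bW := tens2_bilin (ract_bilin W) (ract_bilin C).
transitivity (\T_(a, b <- e) (tens2 (@ract K H W) (@ract K H C)
    (tmap f idfun (tens2 (@ract K H V) (@ract K H C) (rV v) (hdelta H a))) (hdelta H b))).
  rewrite lin_tlift; last lin.
  by apply: eq_tlift => a b; rewrite rWl.2 hf rVl.2.
elim/tens_ind: (rV v) => [x c|x y hx hy]; last first.
  rewrite [RHS]linearD /= -hx -hy -[X in _ = X + _]scale1r; apply: tlift_funP => a b.
  by rewrite (bilinDl bV) linearD (bilinDl bW) scale1r.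
transitivity (\T_(a, b <- e) \D_(a1, a2 <- a) \D_(b1, b2 <- b)
    tmk (ract (f (ract x a1)) b1) (ract c (a2 * b2))).
  apply: eq_tlift => a b; rewrite /tens2 tlift_tmap; last lin.
  rewrite tlift_tlift; last lin.
  rewrite tlift_tmk; last lin.
  rewrite tlift_tlift; last lin.
  apply: eq_tlift => a1 a2; rewrite tlift_tmk; last lin.
  by apply: eq_tlift => b1 b2; rewrite ractM.
rewrite (sepelt_codiag_r he (f := fun p q r => tmk (ract (f (ract x p)) q) (ract c r)));
  last lin.
by rewrite tmapE ract1 -(lin_tlift (g := fun u => tmk u c)) //; lin.
Qed.
End Right.
End Colinearity.

Definition biavg (V W : hbimod H) (f : {linear V -> W}) : {linear V -> W} := lavg (ravg f).

(** The right average is taken first; the left one then adds left linearity and inherits right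
    linearity. *)
Lemma biavg_hbimod_hom (V W : hbimod H) (f : {linear V -> W}) : is_hbimod_hom (biavg f).
Proof.
split=> [h v|v h]; first exact: lavg_lact.
by apply: lavg_ract => {}v; apply: ravg_ract.
Qed.

Lemma biavg_id (V W : hbimod H) (f : {linear V -> W}) : is_hbimod_hom f -> biavg f = f.
Proof.
case=> fl fr; apply: lin_ext => v.
have rid u : ravg f u = f u by apply: ravg_id.
rewrite /= lavg_id; first exact: rid.
by move=> h u /=; rewrite !rid fl.
Qed.

Lemma biavg_comp (V V' W W' : hbimod H) (g : {linear W -> W'}) (f : {linear V' -> V})
    (u : {linear V -> W}) : is_hbimod_hom g -> is_hbimod_hom f ->
  biavg (g \o u \o f) = g \o biavg u \o f.
Proof.
move=> [gl gr] [fl fr]; apply: lin_ext => v /=.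
rewrite -lavg_comp //; apply: eq_tlift => a b; congr lact; exact: ravg_comp.
Qed.

(** The retraction is [biavg]: averaging forces [H]-bilinearity, and bicolinearity passes from [f]
    to its right average and from there to the left one. *)
Lemma separable_forget_bicomod (C : coalgebra_in (hbimod_monoidal H)) :
  separable_functor (forget_bicomod C).
Proof.
have P1 (X Y : bicomod_cat C) (f : Defs.Hom (forget_bicomod C X) (forget_bicomod C Y)) :
    @is_hbimod_hom K H (bicomob X) (bicomob Y)
      (@biavg (bicomob X) (bicomob Y) (sval f)).
  exact: biavg_hbimod_hom.
have P2 (X Y : bicomod_cat C) (f : Defs.Hom (forget_bicomod C X) (forget_bicomod C Y)) :
    @is_bicomod_hom (hbimod_monoidal H) C X Y (exist _ _ (P1 X Y f)).
  case: f P1 => f [fl fr] P1; split; apply: boolp.eq_exist; apply: lin_ext => v.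
    apply: (lavg_colinear_l (C := coalgob C) (svalP (bcl X)) (svalP (bcl Y))) => u.
    apply: (ravg_colinear_l (C := coalgob C) (svalP (bcl X)) (svalP (bcl Y))) => w.
    exact: (lin_congr fl w).
  apply: (lavg_colinear_r (C := coalgob C) (svalP (bcr X)) (svalP (bcr Y))) => u.
  apply: (ravg_colinear_r (C := coalgob C) (svalP (bcr X)) (svalP (bcr Y))) => w.
  exact: (lin_congr fr w).
exists (fun X Y f => exist _ _ (P2 X Y f)); split=> [X X' Y Y' f g h|X Y f].
  apply: boolp.eq_exist; apply: boolp.eq_exist.
  exact: biavg_comp (svalP (sval g)) (svalP (sval f)).
case: f => [[f fb] fc]; do 2!apply: boolp.eq_exist; exact: biavg_id.
Qed.
End Averaging.

(** If $s$ splits $U(f)$, naturality of the retraction $P$ gives $f\circ P(s)=P(U(f)\circ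
    s)=P(U(\mathrm{id}))=\mathrm{id}$. *)
Lemma separable_has_section (B A : category) (U : Defs.functor B A) (X Y : B)
    (f : Defs.Hom X Y) :
  separable_functor U -> has_section (fhom U f) -> has_section f.
Proof.
case=> P [nat ret] [s hs]; exists (P Y X s).
(* Composing with an identity on the right produces the three-term shape of [nat]. *)
rewrite -[f \oc _]compc1 -nat hs fhom1 comp1c -fhom1; exact: ret.
Qed.

Lemma separable_relprojective (B A : category) (U : Defs.functor B A) (P : B) :
  separable_functor U -> relprojective U P.
Proof.
move=> sU X Y f /(separable_has_section sU)[s hs] g.
by exists (s \oc g); rewrite -compcA hs comp1c.
Qed.

(** * Sections of the multiplication and separability elements *)

Section SeparableAlgebra.
Variables (K : fieldType) (H : hopf_algebra K).
Notation HH := (tensor H H).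
Notation Dl := (codiag_l (hdelta H) (hdelta H)).
Notation Dr := (codiag_r (hdelta H) (hdelta H)).

(** The actions on the outer factors make $H\otimes H$ the free bimodule on one generator, as
    opposed to the diagonal actions of [hbimod_tensor]. *)
Definition free_lact (h : H) (x : HH) : HH := \T_(a, b <- x) tmk (h * a) b.
Definition free_ract (x : HH) (h : H) : HH := \T_(a, b <- x) tmk a (b * h).

Lemma free_lact_bilin : bilin free_lact.
Proof. by rewrite /free_lact; lin. Qed.
Lemma free_ract_bilin : bilin free_ract.
Proof. by rewrite /free_ract; lin. Qed.
Lemma free_lactE h a b : free_lact h (tmk a b) = tmk (h * a) b.
Proof. by rewrite /free_lact tlift_tmk //; lin. Qed.
Lemma free_ractE h a b : free_ract (tmk a b) h = tmk a (b * h).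
Proof. by rewrite /free_ract tlift_tmk //; lin. Qed.

Lemma free_lactM g h x : free_lact (g * h) x = free_lact g (free_lact h x).
Proof.
elim/tens_ind: x => [a b|x y hx hy]; first by rewrite !free_lactE mulrA.
by rewrite !(bilinDr free_lact_bilin) hx hy.
Qed.
Lemma free_ractM x g h : free_ract x (g * h) = free_ract (free_ract x g) h.
Proof.
elim/tens_ind: x => [a b|x y hx hy]; first by rewrite !free_ractE mulrA.
by rewrite !(bilinDl free_ract_bilin) hx hy.
Qed.

Definition free_hbimod : hbimod H.
Proof.
refine (@Hbimod K H HH free_lact free_ract free_lact_bilin free_ract_bilin _ _ _ _ _).
- elim/tens_ind=> [a b|x y hx hy]; first by rewrite free_lactE mul1r.
  by rewrite (bilinDr free_lact_bilin) hx hy.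
- exact: free_lactM.
- elim/tens_ind=> [a b|x y hx hy]; first by rewrite free_ractE mulr1.
  by rewrite (bilinDl free_ract_bilin) hx hy.
- exact: free_ractM.
- move=> g; elim/tens_ind=> [a b|x y hx hy] h.
    by rewrite free_ractE !free_lactE free_ractE.
  by rewrite !(bilinDr free_lact_bilin, bilinDl free_ract_bilin) hx hy.
Defined.

(** Rests on multiplicativity of the coproduct. With the next three lemmas it makes both codiagonal
    coactions [H]-bilinear, so that $H\otimes H$ is a Hopf bimodule. *)
Lemma codiag_l_free_lact h x : Dl (free_lact h x) = tens2 *%R free_lact (hdelta H h) (Dl x).
Proof.
have tb := tens2_bilin (hmul_bilin H) free_lact_bilin.
have mb := tens2_bilin (hmul_bilin H) (hmul_bilin H).
have ub := tens2_bilin (hmul_bilin H) (tmk_bilin H H).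
elim/tens_ind: x => [a b|x y hx hy]; last first.
  by rewrite (bilinDr free_lact_bilin) !linearD /= (bilinDr tb) hx hy.
rewrite free_lactE !codiag_lE hdeltaM.
elim/tens_ind: (hdelta H h) => [h1 h2|x y hx hy]; last first.
  by rewrite (bilinDl mb) (bilinDl tb) (bilinDl ub) hx hy.
elim/tens_ind: (hdelta H a) => [a1 a2|x y hx hy]; last first.
  by rewrite (bilinDr mb) !(bilinDl ub) (bilinDr tb) hx hy.
elim/tens_ind: (hdelta H b) => [b1 b2|x y hx hy]; last first.
  by rewrite !(bilinDr ub) (bilinDr tb) hx hy.
by rewrite !tens2E ?free_lactE ?mulrA //;
   first [exact: hmul_bilin|exact: tmk_bilin|exact: free_lact_bilin].
Qed.

Lemma codiag_l_free_ract x h : Dl (free_ract x h) = tens2 *%R free_ract (Dl x) (hdelta H h).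
Proof.
have tb := tens2_bilin (hmul_bilin H) free_ract_bilin.
have mb := tens2_bilin (hmul_bilin H) (hmul_bilin H).
have ub := tens2_bilin (hmul_bilin H) (tmk_bilin H H).
elim/tens_ind: x => [a b|x y hx hy]; last first.
  by rewrite (bilinDl free_ract_bilin) !linearD /= (bilinDl tb) hx hy.
rewrite free_ractE !codiag_lE hdeltaM.
elim/tens_ind: (hdelta H h) => [h1 h2|x y hx hy]; last first.
  by rewrite (bilinDr mb) (bilinDr tb) (bilinDr ub) hx hy.
elim/tens_ind: (hdelta H a) => [a1 a2|x y hx hy]; last first.
  by rewrite !(bilinDl ub) (bilinDl tb) hx hy.
elim/tens_ind: (hdelta H b) => [b1 b2|x y hx hy]; last first.
  by rewrite (bilinDl mb) !(bilinDr ub) (bilinDl tb) hx hy.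
by rewrite !tens2E ?free_ractE ?mulrA //;
   first [exact: hmul_bilin|exact: tmk_bilin|exact: free_ract_bilin].
Qed.

Lemma codiag_r_free_lact h x : Dr (free_lact h x) = tens2 free_lact *%R (hdelta H h) (Dr x).
Proof.
have tb := tens2_bilin free_lact_bilin (hmul_bilin H).
have mb := tens2_bilin (hmul_bilin H) (hmul_bilin H).
have ub := tens2_bilin (tmk_bilin H H) (hmul_bilin H).
elim/tens_ind: x => [a b|x y hx hy]; last first.
  by rewrite (bilinDr free_lact_bilin) !linearD /= (bilinDr tb) hx hy.
rewrite free_lactE !codiag_rE hdeltaM.
elim/tens_ind: (hdelta H h) => [h1 h2|x y hx hy]; last first.
  by rewrite (bilinDl mb) (bilinDl tb) (bilinDl ub) hx hy.
elim/tens_ind: (hdelta H a) => [a1 a2|x y hx hy]; last first.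
  by rewrite (bilinDr mb) !(bilinDl ub) (bilinDr tb) hx hy.
elim/tens_ind: (hdelta H b) => [b1 b2|x y hx hy]; last first.
  by rewrite !(bilinDr ub) (bilinDr tb) hx hy.
by rewrite !tens2E ?free_lactE ?mulrA //;
   first [exact: hmul_bilin|exact: tmk_bilin|exact: free_lact_bilin].
Qed.

Lemma codiag_r_free_ract x h : Dr (free_ract x h) = tens2 free_ract *%R (Dr x) (hdelta H h).
Proof.
have tb := tens2_bilin free_ract_bilin (hmul_bilin H).
have mb := tens2_bilin (hmul_bilin H) (hmul_bilin H).
have ub := tens2_bilin (tmk_bilin H H) (hmul_bilin H).
elim/tens_ind: x => [a b|x y hx hy]; last first.
  by rewrite (bilinDl free_ract_bilin) !linearD /= (bilinDl tb) hx hy.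
rewrite free_ractE !codiag_rE hdeltaM.
elim/tens_ind: (hdelta H h) => [h1 h2|x y hx hy]; last first.
  by rewrite (bilinDr mb) (bilinDr tb) (bilinDr ub) hx hy.
elim/tens_ind: (hdelta H a) => [a1 a2|x y hx hy]; last first.
  by rewrite !(bilinDl ub) (bilinDl tb) hx hy.
elim/tens_ind: (hdelta H b) => [b1 b2|x y hx hy]; last first.
  by rewrite (bilinDl mb) !(bilinDr ub) (bilinDl tb) hx hy.
by rewrite !tens2E ?free_ractE ?mulrA //;
   first [exact: hmul_bilin|exact: tmk_bilin|exact: free_ract_bilin].
Qed.

Lemma codiag_l_free_hbimod :
  @is_hbimod_hom K H free_hbimod (hbimod_tensor (hopf_bimod H) free_hbimod) (Dl : {linear _ -> _}).
Proof. by split=> [h x|x h]; [apply: codiag_l_free_lact|apply: codiag_l_free_ract]. Qed.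
Lemma codiag_r_free_hbimod :
  @is_hbimod_hom K H free_hbimod (hbimod_tensor free_hbimod (hopf_bimod H)) (Dr : {linear _ -> _}).
Proof. by split=> [h x|x h]; [apply: codiag_r_free_lact|apply: codiag_r_free_ract]. Qed.

Notation HC := (hopf_bimod_coalg H).
Notation bim := (hbimod_monoidal H).

Definition free_hopf_bimod : bicomodule HC.
Proof.
refine (@Bicomodule bim HC free_hbimod
  (exist _ (Dl : {linear _ -> _}) codiag_l_free_hbimod)
  (exist _ (Dr : {linear _ -> _}) codiag_r_free_hbimod) _ _ _ _ _);
apply: boolp.eq_exist; apply: lin_ext => x.
- by apply: codiag_lA => v; exact: hdeltaA.
- by apply: codiag_l1 => v; exact: tlunit_heps.
- by apply: codiag_rA => v; exact: hdeltaA.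
- by apply: codiag_r1 => v; exact: trunit_heps.
- by apply: codiag_lr => v; exact: hdeltaA.
Defined.

Definition regular_hopf_bimod : bicomodule HC.
Proof.
refine (@Bicomodule bim HC (hopf_bimod H)
  (exist _ (hdelta H) (hdelta_hbimod H)) (exist _ (hdelta H) (hdelta_hbimod H)) _ _ _ _ _);
apply: boolp.eq_exist; apply: lin_ext => h.
- exact: hdeltaA.
- exact: tlunit_heps.
- exact: hdeltaA.
- exact: trunit_heps.
- exact: hdeltaA.
Defined.

Lemma hmulE (a b : H) : hmul (tmk a b) = a * b.
Proof. exact: (tlift_tmk a b (hmul_bilin H)). Qed.

Lemma hmul_free_hbimod : @is_hbimod_hom K H free_hbimod (hopf_bimod H) (@hmul K H).
Proof.
split=> [h x|x h]; elim/tens_ind: x => [a b|x y hx hy].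
- by rewrite /= free_lactE !hmulE mulrA.
- by rewrite /= (bilinDr free_lact_bilin) !linearD /= hx hy mulrDr.
- by rewrite /= free_ractE !hmulE mulrA.
- by rewrite /= (bilinDl free_ract_bilin) !linearD /= hx hy mulrDl.
Qed.

Definition free_mul : @Defs.Hom (bicomod_cat HC) free_hopf_bimod regular_hopf_bimod.
Proof.
exists (exist _ (@hmul K H : {linear _ -> _}) hmul_free_hbimod).
have [l r] := hmul_bicomod_subproof H.
by split; apply: boolp.eq_exist; [exact: l|exact: r].
Defined.

Definition insert1 (h : H) : HH := tmk h 1.
Lemma insert1_linear : linear insert1.
Proof. by change (lin insert1); rewrite /insert1; lin. Qed.
HB.instance Definition _ := GRing.isLinear.Build K H HH *:%R insert1 insert1_linear.

(** The second factor contributes only $\Delta(1)=1\otimes1$, so the codiagonal coactions reduce to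
    the coproduct of the first. *)
Lemma insert1_bicomod_hom :
  @is_bicomod_hom (vect K) (hopf_coalg H) (hopf_bicomod H)
    (bicomod_tensor (hopf_bicomod H) (hopf_bicomod H)) (insert1 : {linear _ -> _}).
Proof.
split; apply: lin_ext => h.
  change (Dl (tmk h 1) = tmap idfun insert1 (hdelta H h)).
  rewrite codiag_lE hdelta1; elim/tens_ind: (hdelta H h) => [a b|x y hx hy].
    by rewrite tens2E ?tmapE ?mulr1 //; [exact: hmul_bilin|exact: tmk_bilin].
  by rewrite (bilinDl (tens2_bilin (hmul_bilin H) (tmk_bilin H H))) linearD /= hx hy.
change (Dr (tmk h 1) = tmap insert1 idfun (hdelta H h)).
rewrite codiag_rE hdelta1; elim/tens_ind: (hdelta H h) => [a b|x y hx hy].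
  by rewrite tens2E ?tmapE ?mulr1 //; [exact: tmk_bilin|exact: hmul_bilin].
by rewrite (bilinDl (tens2_bilin (tmk_bilin H H) (hmul_bilin H))) linearD /= hx hy.
Qed.

(** Bilinearity gives $h\,s(1)=s(h)=s(1)\,h$. The hypotheses concern a bare linear map, so that
    sections from both categories, Hopf bimodules and bimodules over the algebra [H] in bicomodules,
    fit. *)
Lemma section_sepelt (s : {linear H -> HH}) :
  (forall h g, s (h * g) = free_lact h (s g)) -> (forall g h, s (g * h) = free_ract (s g) h) ->
  (forall h, hmul (s h) = h) ->
  (forall h, Dl (s h) = tmap idfun s (hdelta H h)) ->
  (forall h, Dr (s h) = tmap s idfun (hdelta H h)) ->
  separability_element (s 1).
Proof.
move=> sl sr sm dl dr; split.
- by move=> h; have := sl h 1; rewrite mulr1 -[in LHS](mul1r h) sr => /esym.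
- exact: sm.
- by rewrite dl hdelta1 tmapE.
- by rewrite dr hdelta1 tmapE.
Qed.

Lemma separable_forget_sepelt :
  separable_functor (forget_bicomod HC) -> exists e : HH, separability_element e.
Proof.
move=> sep; have /(separable_has_section sep)[[[s [sl sr]] [dl dr]] hs] :
    has_section (fhom (forget_bicomod HC) free_mul).
  exists (exist _ (insert1 : {linear _ -> _}) insert1_bicomod_hom).
  apply: boolp.eq_exist; apply: lin_ext => h.
  by change (hmul (tmk h 1) = h); rewrite hmulE mulr1.
exists (s 1); apply: section_sepelt.
- exact: sl.
- exact: sr.
- by move=> h; exact: (lin_congr (congr1 (fun f => sval (sval f)) hs) h).
- by move=> h; exact: (lin_congr (congr1 sval dl) h).
- by move=> h; exact: (lin_congr (congr1 sval dr) h).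
Qed.

Lemma separable_algebra_sepelt :
  separable_algebra (hopf_algebra_in H) -> exists e : HH, separability_element e.
Proof.
case=> [[[s0 [dl dr]] [sl sr]] hs]; pose s : {linear H -> HH} := s0.
(* The bimodule structures of the abstract monoidal category unfold by conversion to formulas with
   associators; on pure tensors these become [free_lact] and [free_ract]. *)
have sL (x : HH) : s (hmul x) = tmap (@hmul K H) (idfun : {linear H -> H})
    (tassocV (tmap (idfun : {linear H -> H}) s x)) := lin_congr (congr1 sval sl) x.
have sR (x : HH) : s (hmul x) = tmap (idfun : {linear H -> H}) (@hmul K H)
    (tassoc (tmap s (idfun : {linear H -> H}) x)) := lin_congr (congr1 sval sr) x.
exists (s 1); apply: section_sepelt.
- move=> h g; have := sL (tmk h g).
  rewrite hmulE tmapE => ->; elim/tens_ind: (s g) => [a b|x y hx hy].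
    by rewrite tassocVE tmapE /= hmulE free_lactE.
  by rewrite (bilinDr free_lact_bilin) tmkDr !linearD /= hx hy.
- move=> g h; have := sR (tmk g h).
  rewrite hmulE tmapE => ->; elim/tens_ind: (s g) => [a b|x y hx hy].
    by rewrite tassocE tmapE /= hmulE free_ractE.
  by rewrite (bilinDl free_ract_bilin) tmkDl !linearD /= hx hy.
- by move=> h; exact: (lin_congr (congr1 (fun f => sval (sval f)) hs) h).
- by move=> h; exact: (lin_congr dl h).
- by move=> h; exact: (lin_congr dr h).
Qed.

(** The section is $h\mapsto he=eh$: the first form shows left linearity and, by coinvariance of
    [e], bicolinearity; the second shows right linearity. *)
Lemma sepelt_separable_algebra (e : HH) :
  separability_element e -> separable_algebra (hopf_algebra_in H).
Proof.
move=> he; have ec h : free_lact h e = free_ract e h by case: he => /(_ h).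
have [_ em el er] := he.
(* The existential keeps [s] opaque, with [sE] as its only handle. *)
have [s sE] : exists s : {linear H -> HH}, forall h, s h = free_lact h e.
  by exists (mklin (free_lact_bilin.1 e)).
have s1 : @is_bicomod_hom (vect K) (hopf_coalg H) (hopf_bicomod H)
    (bicomod_tensor (hopf_bicomod H) (hopf_bicomod H)) s.
  split; apply: lin_ext => h.
    change (Dl (s h) = tmap idfun s (hdelta H h)).
    rewrite sE codiag_l_free_lact el; elim/tens_ind: (hdelta H h) => [a b|x y hx hy].
      by rewrite tens2E ?tmapE /= ?mulr1 ?sE //; [exact: hmul_bilin|exact: free_lact_bilin].
    by rewrite (bilinDl (tens2_bilin (hmul_bilin H) free_lact_bilin)) linearD /= hx hy.
  change (Dr (s h) = tmap s idfun (hdelta H h)).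
  rewrite sE codiag_r_free_lact er; elim/tens_ind: (hdelta H h) => [a b|x y hx hy].
    by rewrite tens2E ?tmapE /= ?mulr1 ?sE //; [exact: free_lact_bilin|exact: hmul_bilin].
  by rewrite (bilinDl (tens2_bilin free_lact_bilin (hmul_bilin H))) linearD /= hx hy.
have s2 : @is_bimod_hom _ _ (regular_bimod (hopf_algebra_in H)) (free_bimod (hopf_algebra_in H))
    (exist _ s s1).
  split; apply: boolp.eq_exist; apply: lin_ext => x.
    change (s (hmul x) = tmap (@hmul K H) (idfun : {linear H -> H})
      (tassocV (tmap (idfun : {linear H -> H}) s x))).
    elim/tens_ind: x => [h g|x y hx hy]; last by rewrite !linearD /= hx hy.
    rewrite hmulE tmapE /= !sE free_lactM.
    elim/tens_ind: (free_lact g e) => [a b|x y hx hy].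
      by rewrite tassocVE tmapE /= hmulE free_lactE.
    by rewrite (bilinDr free_lact_bilin) tmkDr !linearD /= hx hy.
  change (s (hmul x) = tmap (idfun : {linear H -> H}) (@hmul K H)
    (tassoc (tmap s (idfun : {linear H -> H}) x))).
  elim/tens_ind: x => [g h|x y hx hy]; last by rewrite !linearD /= hx hy.
  rewrite hmulE tmapE /= !sE !ec free_ractM.
  elim/tens_ind: (free_ract e g) => [a b|x y hx hy].
    by rewrite tassocE tmapE /= hmulE free_ractE.
  by rewrite (bilinDl free_ract_bilin) tmkDl !linearD /= hx hy.
exists (exist _ (exist _ s s1) s2).
apply: boolp.eq_exist; apply: boolp.eq_exist; apply: lin_ext => h.
change (hmul (s h) = h).
rewrite sE hmul_free_hbimod.1 /=; have -> : hmul e = 1 by exact: em.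
exact: mulr1.
Qed.
End SeparableAlgebra.

(** * Averaging linear maps between Yetter-Drinfeld modules *)

Section YetterDrinfeldAveraging.
Variables (K : fieldType) (H : hopf_algebra K).

Notation car V := (lcomob (yd_comod V) : lmodType K).

Section Average.
Variables (e : tensor H H).
Hypothesis he : separability_element e.

Definition yavg (V W : ydmod H) (f : {linear car V -> car W}) (v : car V) : car W :=
  \T_(a, b <- e) yact a (f (yact b v)).

Lemma yavg_linear (V W : ydmod H) (f : {linear car V -> car W}) : linear (yavg f).
Proof. by change (lin (yavg f)); rewrite /yavg; lin. Qed.
HB.instance Definition _ (V W : ydmod H) (f : {linear car V -> car W}) :=
  GRing.isLinear.Build K (car V) (car W) *:%R (yavg f) (yavg_linear f).

Lemma yavg_yact (V W : ydmod H) (f : {linear car V -> car W}) h v :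
  yavg f (yact h v) = yact h (yavg f v).
Proof.
rewrite [RHS](lin_tlift (g := yact h)); last lin.
transitivity (\T_(a, b <- e) yact (h * a) (f (yact b v))); last first.
  by apply: eq_tlift => a b; rewrite yactM.
rewrite (sepelt_comm he (f := fun a b => yact a (f (yact b v)))); last lin.
by apply: eq_tlift => a b; rewrite yactM.
Qed.

Lemma yavg_id (V W : ydmod H) (f : {linear car V -> car W}) v :
  (forall h v, f (yact h v) = yact h (f v)) -> yavg f v = f v.
Proof.
move=> hf; rewrite -[RHS]yact1 -(sepelt_mul he (f := fun h => yact h (f v))); last lin.
by apply: eq_tlift => a b; rewrite hf yactM.
Qed.

Lemma yavg_comp (V V' W W' : ydmod H) (g : {linear car W -> car W'})
    (f : {linear car V' -> car V}) (u : {linear car V -> car W}) v :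
  (forall h w, g (yact h w) = yact h (g w)) -> (forall h v, f (yact h v) = yact h (f v)) ->
  yavg (g \o u \o f) v = g (yavg u (f v)).
Proof.
move=> hg hf; rewrite [RHS]lin_tlift; last lin.
by apply: eq_tlift => a b; rewrite /= hf hg.
Qed.

(** The coaction of $e'f(e''v)$ is $e'_1e''_1v_{-1}S(e'_3e''_3)\otimes e'_2f(e''_2v_0)$. Right
    coinvariance of [e] turns $e'_3e''_3$ into $1$, then left coinvariance does the same for
    $e'_1e''_1$. *)
Lemma yavg_colinear (V W : ydmod H) (f : {linear car V -> car W}) v :
  (forall v, lcoact W (f v) = tmap idfun f (lcoact V v)) ->
  lcoact W (yavg f v) = tmap idfun (yavg f) (lcoact V v).
Proof.
move=> hf.
pose F (p q r : H) : tensor H (car W) :=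
  \T_(v1, v0 <- lcoact V v) tmk (p * v1) (yact q (f (yact r v0))).
transitivity (\T_(a, b <- e) \D_(a1, a2 <- a) \D_(b1, b2 <- b)
   \D_(p, q <- a1) \D_(p', q' <- b1)
     \T_(v1, v0 <- lcoact V v) tmk (p * p' * v1 * hS H (a2 * b2)) (yact q (f (yact q' v0)))).
  rewrite lin_tlift; last lin.
  apply: eq_tlift => a b; rewrite yd_compat /sweedler3; apply: eq_tlift => a1 a2.
  rewrite [RHS]tlift_exch; apply: eq_tlift => p q.
  rewrite hf tlift_tmap; last lin.
  rewrite yd_compat /sweedler3 tlift_tlift; last lin.
  apply: eq_tlift => b1 b2; rewrite tlift_tlift; last lin.
  apply: eq_tlift => p' q'; rewrite tlift_tlift; last lin.
  apply: eq_tlift => v1 v0; rewrite tlift_tmk /=; last lin.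
  by rewrite antipodeM !mulrA.
rewrite (sepelt_codiag_r he (f := fun x y z => \D_(p, q <- x) \D_(p', q' <- y)
     \T_(v1, v0 <- lcoact V v) tmk (p * p' * v1 * hS H z) (yact q (f (yact q' v0)))));
  last lin.
transitivity (\T_(a, b <- e) \D_(p, q <- a) \D_(p', q' <- b) F (p * p') q q').
  apply: eq_tlift => a b; apply: eq_tlift => p q; apply: eq_tlift => p' q'.
  by apply: eq_tlift => v1 v0; rewrite antipode1 mulr1.
rewrite (sepelt_codiag_l he); last by rewrite /F; lin.
rewrite /F tlift_exch; apply: eq_tlift => v1 v0.
by rewrite (lin_tlift (g := tmk v1)) ?mul1r //; lin.
Qed.

Lemma separable_forget_yd : separable_functor (forget_yd H).
Proof.
have P1 (V W : yd_cat H) (f : Defs.Hom (forget_yd H V) (forget_yd H W)) :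
    @is_lcomod_hom (vect K) (hopf_coalg H) (yd_comod V) (yd_comod W)
      (@yavg V W (sval f) : {linear _ -> _}).
  case: f => f hf; apply: lin_ext => v.
  apply: (@yavg_colinear V W f) => u; exact: (lin_congr hf u).
have P2 (V W : yd_cat H) (f : Defs.Hom (forget_yd H V) (forget_yd H W)) :
    @is_yd_hom K H V W (exist _ _ (P1 V W f)).
  by move=> h v; apply: (@yavg_yact V W (sval f)).
exists (fun V W f => exist _ _ (P2 V W f)); split=> [X X' Y Y' f g u|X Y f].
  apply: boolp.eq_exist; apply: boolp.eq_exist; apply: lin_ext => v.
  exact: (@yavg_comp X X' Y Y' (sval (sval g)) (sval (sval f)) (sval u) v (svalP g) (svalP f)).
case: f => [[f fc] fy]; do 2!apply: boolp.eq_exist; apply: lin_ext => v.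
exact: (@yavg_id X Y f v fy).
Qed.
End Average.

(** * The Yetter-Drinfeld module [H] with adjoint coaction, and the integral *)

Definition adcoact (h : H) : tensor H H :=
  sweedler3 (fun a b c => tmk (a * hS H c) b) h.

Lemma adcoact_linear : linear adcoact.
Proof. by change (lin adcoact); rewrite /adcoact /sweedler3; lin. Qed.
HB.instance Definition _ := GRing.isLinear.Build K H (tensor H H) *:%R adcoact adcoact_linear.

Lemma tlift_adcoact (Z : lmodType K) (f : H -> H -> Z) h : bilin f ->
  tlift f (adcoact h) = \D_(x, c <- h) \D_(a, b <- x) f (a * hS H c) b.
Proof.
move=> hf; rewrite /adcoact /sweedler3 tlift_tlift //; apply: eq_tlift => x c.
by rewrite tlift_tlift //; apply: eq_tlift => a b; rewrite tlift_tmk.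
Qed.

(** Both sides are $h_1S(h_5)\otimes h_2S(h_4)\otimes h_3$, the left one because $S$ reverses the
    coproduct. *)
Lemma adcoactA h : tassoc (tmap (hdelta H) (idfun : {linear H -> H}) (adcoact h)) =
  tmap (idfun : {linear H -> H}) adcoact (adcoact h).
Proof.
pose G (a1 a2 b c1 c2 : H) := tmk (a1 * hS H c2) (tmk (a2 * hS H c1) b).
transitivity (\D_(x, c <- h) \D_(a, b <- x) \D_(a1, a2 <- a) \D_(c1, c2 <- c) G a1 a2 b c1 c2).
  rewrite {1}/tmap tlift_adcoact; last lin.
  rewrite lin_tlift; last lin.
  apply: eq_tlift => x c; rewrite lin_tlift; last lin.
  apply: eq_tlift => a b; rewrite -[hdelta H (a * _)]tmk_tlift tlift_deltaM; last lin.
  rewrite (lin_tlift (g := fun u => tassoc (tmk u b))); last lin.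
  apply: eq_tlift => a1 a2; rewrite delta_antipode.
  rewrite (lin_tlift (g := fun u => tassoc (tmk u b))); last lin.
  rewrite tlift_tlift; last lin.
  by apply: eq_tlift => c1 c2; rewrite tlift_tmk ?tassocE //; lin.
transitivity (\D_(x, c <- h) \D_(a, b <- x) \D_(y, b3 <- b) \D_(b1, b2 <- y) G a b1 b2 b3 c);
  last first.
  rewrite {1}/tmap tlift_adcoact; last lin.
  apply: eq_tlift => x c; apply: eq_tlift => a b.
  rewrite /= {1}/adcoact /sweedler3 lin_tlift; last lin.
  apply: eq_tlift => y b3; rewrite lin_tlift; last lin.
  by [].
transitivity (\D_(x, c <- h) \D_(c1, c2 <- c) \D_(a, b <- x) \D_(a1, a2 <- a)
    G a1 a2 b c1 c2).
  apply: eq_tlift => x c; rewrite [RHS]tlift_exch; apply: eq_tlift => a b; exact: tlift_exch.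
(* Only two groupings of the same five legs remain to be matched. *)
rewrite /G -coassoc; last lin.
apply: eq_tlift => x c; rewrite -[RHS]coassoc; last lin.
by apply: eq_tlift => y b3; rewrite coassoc //; lin.
Qed.

(** Since $\varepsilon\circ S=\varepsilon$, both outer legs are absorbed by counits. *)
Lemma adcoact1 h : tlunit (tmap (heps H) (idfun : {linear H -> H}) (adcoact h)) = h.
Proof.
rewrite /tmap tlift_adcoact; last lin.
rewrite lin_tlift; last lin.
rewrite -[RHS](@counitr _ _ _ idfun) //; apply: eq_tlift => x c.
rewrite -(@counitl _ _ _ (fun x => (heps H c : K) *: idfun x)); last lin.
rewrite lin_tlift; last lin.
apply: eq_tlift => a b.
by rewrite tlunitE /= hepsM counit_antipode scalerA.
Qed.

(** Antimultiplicativity of $S$ nests $v_1S(v_3)$ between $h_1$ and $S(h_3)$. *)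
Lemma adcoact_compat h v : adcoact (h * v) =
  sweedler3 (fun h1 h2 h3 : H =>
    tlift (fun v1 v0 => tmk (h1 * v1 * hS H h3) (h2 * v0)) (adcoact v)) h.
Proof.
rewrite /adcoact {1}/sweedler3 tlift_deltaM; last lin.
apply: eq_tlift => hx hc.
transitivity (\D_(vx, vc <- v) \D_(ha, hb <- hx) \D_(va, vb <- vx)
    tmk (ha * (va * hS H vc) * hS H hc) (hb * vb)).
  apply: eq_tlift => vx vc; rewrite tlift_deltaM; last lin.
  apply: eq_tlift => ha hb; apply: eq_tlift => va vb.
  by rewrite antipodeM !mulrA.
rewrite tlift_exch; apply: eq_tlift => ha hb.
by rewrite -/(adcoact v) tlift_adcoact //; lin.
Qed.

Definition ad_lcomod : lcomodule (hopf_coalg H).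
Proof.
refine (@Lcomodule (vect K) (hopf_coalg H) (H : lmodType K) (adcoact : {linear _ -> _}) _ _);
apply: lin_ext => h; [exact: adcoactA|exact: adcoact1].
Defined.

Definition ad_yd : ydmod H.
Proof.
refine (@Ydmod K H ad_lcomod (fun g h : H => g * h) (hmul_bilin H) _ _ adcoact_compat).
- exact: mul1r.
- by move=> g h v; rewrite mulrA.
Defined.

(** The counit removes the middle leg, and $h_1S(h_2)=\varepsilon(h)1$ does the rest. *)
Lemma heps_colinear h : triv_l H (heps H h) = tmap (idfun : {linear H -> H}) (heps H) (adcoact h).
Proof.
rewrite /tmap tlift_adcoact; last lin.
transitivity (\D_(x, c <- h) tmk (x * hS H c) (1 : K^o)).
  rewrite (antipoder (f := fun u => tmk u (1 : K^o))); last lin.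
  by rewrite /triv_l -tmkZr /GRing.scale /= mulr1.
apply: eq_tlift => x c; rewrite -(counitr (f := fun x => tmk (x * hS H c) (1 : K^o))); last lin.
by apply: eq_tlift => a b; rewrite -tmkZr /GRing.scale /= mulr1.
Qed.

Definition heps_yd : @Defs.Hom (yd_cat H) ad_yd (triv_yd H).
Proof.
unshelve refine (exist _ (exist _ (heps H) _) _).
  by apply: lin_ext => h; exact: heps_colinear.
by move=> h v; exact: hepsM.
Defined.

(** The unit map [hone] is colinear because $1$ is coinvariant under [adcoact], and
    $\varepsilon(1)=1$. *)
Lemma heps_yd_section : has_section (fhom (forget_yd H) heps_yd).
Proof.
unshelve eexists (exist _ (@hone K H : {linear _ -> _}) _).
  apply: lin_ext => k.
  change (adcoact ((k : K) *: 1) = tmap (idfun : {linear H -> H}) (@hone K H) (tmk 1 k)).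
  rewrite linearZ /= tmapE /= /hone tmkZr; congr (_ *: _).
  by rewrite /adcoact /sweedler3 !tlift_delta1 ?antipode1 ?mulr1 //; lin.
apply: boolp.eq_exist; apply: lin_ext => k.
change (heps H ((k : K) *: 1) = k :> K).
by rewrite linearZ /= heps1 /GRing.scale /= mulr1.
Qed.

(** Let $g$ lift the identity of $K$ along the counit and $t=g(1)$. Then [H]-linearity of $g$ makes
    $t$ an integral, colinearity makes it $ad$-coinvariant, and the lifting equation gives
    $\varepsilon(t)=1$. *)
Lemma relprojective_integral :
  relprojective (forget_yd H) (triv_yd H) -> exists t : H, ad_coinvariant_integral t.
Proof.
case/(_ ad_yd (triv_yd H) heps_yd heps_yd_section (@idc (yd_cat H) (triv_yd H))).
move=> [[g0 gco] gact] geps; pose g : {linear K^o -> H} := g0.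
exists (g 1); split.
- move=> h; rewrite -linearZ; exact/esym/(gact h (1 : K^o)).
- have := lin_congr gco 1.
  change (adcoact (g 1) = tmap (idfun : {linear H -> H}) g (tmk 1 (1 : K^o)) ->
    adcoact (g 1) = tmk 1 (g 1)).
  by rewrite tmapE.
- exact: (lin_congr (congr1 (fun f => sval (sval f)) geps) 1).
Qed.
End YetterDrinfeldAveraging.

Theorem theorem7p7 (K : fieldType) (H : hopf_algebra K) :
  [<-> (exists t : H, ad_coinvariant_integral t);
       (forall C : coalgebra_in (hbimod_monoidal H),
          separable_functor (forget_bicomod C));
       separable_functor (forget_bicomod (hopf_bimod_coalg H));
       separable_algebra (hopf_algebra_in H);
       separable_functor (forget_yd H);
       relprojective (forget_yd H) (triv_yd H)].
Proof.
(* A cycle in the listed order; its first, third and fourth implications pass through a separability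
   element. *)
tfae.
- by case=> t /integral_sepelt he C; apply: (separable_forget_bicomod he).
- by apply.
- by case/separable_forget_sepelt=> e; apply: sepelt_separable_algebra.
- by case/separable_algebra_sepelt=> e; apply: separable_forget_yd.
- exact: separable_relprojective.
- exact: relprojective_integral.
Qed.
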